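(* Let $\mathbb R^d=\mathbb R^{d_1}\times\cdots\times\mathbb R^{d_n}$, let $p=1$, and let the uncertainty domain be the polyhedral set $\Xi:=\{\xi\in\mathbb R^d:\ C\xi\preceq f\}$, where $C\in\mathbb R^{r\times d}$ and $f\in\mathbb R^r$. Let $Q=\sum_{l=1}^M\vartheta_l\delta_{\xi^l}$ be a discrete distribution with atoms $\xi^1,\ldots,\xi^M\in\Xi$ and masses $\vartheta_1,\ldots,\vartheta_M$, let $\bm\varepsilon\succeq0$, and let $h_j(\xi):=\langle\alpha_j,\xi\rangle+b_j$ with $\alpha_j\in\mathbb R^d$, $b_j\in\mathbb R$, $j\in[m]$. (i) If $h(\xi)=\max_{j\in[m]}h_j(\xi)$, then $\sup_{P\in\mathcal T_1(Q,\bm\varepsilon)}\mathbb E_P[h(\xi)]$ equals the optimal value of $$\begin{aligned}\inf_{\bm\lambda,\,s_l,\,\gamma_{lj}}\ &\langle\bm\lambda,\bm\varepsilon\rangle+\sum_{l=1}^M\vartheta_l s_l\\ \text{s.t.}\ \ & b_j+\langle\alpha_j,\xi^l\rangle+\langle\gamma_{lj},f-C\xi^l\rangle\le s_l,&& l\in[M],\ j\in[m],\\ &\|\mathrm{pr}_k^{\bm d}(C^\top\gamma_{lj}-\alpha_j)\|_*\le\lambda_k,&& l\in[M],\ j\in[m],\ k\in[n],\\ &\gamma_{lj}\succeq0,&& l\in[M],\ j\in[m].\end{aligned}$$ (ii) If $h(\xi)=\min_{j\in[m]}h_j(\xi)$, then $\sup_{P\in\mathcal T_1(Q,\bm\varepsilon)}\mathbb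 E_P[h(\xi)]$ equals the optimal value of $$\begin{aligned}\inf_{\bm\lambda,\,s_l,\,\gamma_l,\,\theta_l}\ &\langle\bm\lambda,\bm\varepsilon\rangle+\sum_{l=1}^M\vartheta_l s_l\\ \text{s.t.}\ \ &\langle\theta_l,b+A\xi^l\rangle+\langle\gamma_l,f-C\xi^l\rangle\le s_l,&& l\in[M],\\ &\|\mathrm{pr}_k^{\bm d}(C^\top\gamma_l-A^\top\theta_l)\|_*\le\lambda_k,&& l\in[M],\ k\in[n],\\ &\langle\theta_l,\bm 1\rangle=1,&& l\in[M],\\ &\gamma_l\succeq0,\ \theta_l\succeq0,&& l\in[M].\end{aligned}$$ Here $\bm\lambda=(\lambda_1,\ldots,\lambda_n)\in\mathbb R^n$, $s_l\in\mathbb R$, $\gamma_{lj},\gamma_l\in\mathbb R^r$, $\theta_l\in\mathbb R^m$; $A\in\mathbb R^{m\times d}$ is the matrix with rows $\alpha_j^\top$, $b$ is the column vector with entries $b_j$, and $\bm 1$ is the vector of ones.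
   Context: Notation: $[N]:=\{1,\ldots,N\}$; $x\succeq y$ (equivalently $y\preceq x$) means all components of $x-y$ are nonnegative; $\bm d:=(d_1,\ldots,d_n)$, $d=d_1+\cdots+d_n$; elements of $\mathbb R^d$ are written $\xi=(\xi_1,\ldots,\xi_n)$ with $\xi_k\in\mathbb R^{d_k}$, and $\mathrm{pr}_k^{\bm d}(\xi)=\xi_k$. Each $\mathbb R^{d_k}$ carries an (arbitrary) norm denoted $\|\cdot\|$ with dual norm $\|z\|_*:=\sup_{\|\xi\|\le1}\langle z,\xi\rangle$. With $\mathcal P(\cdot)$ denoting Borel probability measures, the multi-transport hyperrectangle for $p=1$ is $$\mathcal T_1(Q,\bm\varepsilon):=\Big\{\mathrm{pr}_{2\#}\pi:\ \pi\in\mathcal P(\Xi\times\Xi),\ \mathrm{pr}_{1\#}\pi=Q,\ \int_{\Xi\times\Xi}\|\zeta_k-\xi_k\|\,d\pi(\zeta,\xi)\le\varepsilon_k\ \text{for all }k\in[n]\Big\},$$ where $\mathrm{pr}_{1\#}\pi,\mathrm{pr}_{2\#}\pi$ are the first and second marginals of $\pi$. *)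

(* Defs.v *)
From HB Require Import structures.
From mathcomp Require Import all_boot all_order all_algebra.
From mathcomp Require Import all_classical all_reals all_analysis.
Set Implicit Arguments.
Unset Strict Implicit.
Unset Printing Implicit Defensive.
Import Order.TTheory GRing.Theory Num.Theory.
Import numFieldNormedType.Exports.
Local Open Scope classical_set_scope.
Local Open Scope ring_scope.

Definition dot (R : realType) (n : nat) (u v : 'cV[R]_n) : R :=
  \sum_(i < n) u i 0 * v i 0.

Definition cle (R : realType) (n : nat) (u v : 'cV[R]_n) : Prop :=
  forall i, u i 0 <= v i 0.

Record is_norm (R : realType) (V : lmodType R) (N : V -> R) : Prop := IsNorm {
  is_norm_ge0 : forall x, 0 <= N x ;
  is_norm_eq0 : forall x, N x = 0 -> x = 0 ;
  is_normZ : forall (a : R) x, N (a *: x) = `|a| * N x ;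
  is_normD : forall x y, N (x + y) <= N x + N y }.

(* [sup] is the supremum of a set of reals; the set below is nonempty and,
   when N is a norm, bounded, so that no default value is involved. *)
Definition dual_norm (R : realType) (n : nat) (N : 'cV[R]_n -> R)
    (z : 'cV[R]_n) : R :=
  sup [set dot z x | x in [set x | N x <= 1]].

(* R^D with the Borel sigma-algebra of its usual topology. On products,
   MathComp-Analysis takes the product sigma-algebra, which here is the Borel
   one because R^D is second countable. *)
Definition borelV (R : realType) (D : nat) : measurableType _ :=
  g_sigma_algebraType (@open 'cV[R]_D).

Definition polyhedron (R : realType) (r D : nat) (C : 'M[R]_(r, D))
    (f : 'cV[R]_r) : set 'cV[R]_D :=
  [set x | cle (C *m x) f].

(* R^d is 'cV[R]_(\sum_k d k) and the k-th projection is [submxcol _ k].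
   A measurableType carries a distinguished point, so the Borel probability
   measures on Xi (resp. Xi x Xi) are represented by the Borel probability
   measures on the ambient space that give mass 1 to Xi (resp. Xi x Xi). *)
Definition multi_transport (R : realType) (n : nat) (d : 'I_n -> nat)
    (N : forall k, 'cV[R]_(d k) -> R) (Xi : set 'cV[R]_(\sum_(k < n) d k))
    (Q : probability (borelV R (\sum_(k < n) d k)) R) (eps : 'cV[R]_n) :
    set (probability (borelV R (\sum_(k < n) d k)) R) :=
  [set P | exists pi : probability
      (borelV R (\sum_(k < n) d k) * borelV R (\sum_(k < n) d k))%type R,
    [/\ pi (Xi `*` Xi) = 1%E,
        forall A, measurable A -> pushforward pi fst A = Q A,
        forall A, measurable A -> pushforward pi snd A = P A &
        forall k, (\int[pi]_w
          (N k (submxcol ((w.1 : 'cV[R]_(\sum_(k < n) d k)) - w.2) k))%:E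
            <= (eps k 0)%:E)%E]].

Definition affine (R : realType) (D m : nat) (alpha : 'I_m -> 'cV[R]_D)
    (b : 'cV[R]_m) (j : 'I_m) (x : 'cV[R]_D) : R :=
  dot (alpha j) x + b j 0.

Definition max_affine (R : realType) (D m : nat)
    (alpha : 'I_m.+1 -> 'cV[R]_D) (b : 'cV[R]_m.+1) (x : 'cV[R]_D) : R :=
  \big[Num.max/affine alpha b ord0 x]_(j < m.+1) affine alpha b j x.

Definition min_affine (R : realType) (D m : nat)
    (alpha : 'I_m.+1 -> 'cV[R]_D) (b : 'cV[R]_m.+1) (x : 'cV[R]_D) : R :=
  \big[Num.min/affine alpha b ord0 x]_(j < m.+1) affine alpha b j x.

Definition row_matrix (R : realType) (D m : nat) (alpha : 'I_m -> 'cV[R]_D) :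
    'M[R]_(m, D) :=
  \matrix_(j, i) alpha j i 0.

(* Main.v *)
(* Call (l, j) -> (p, q) a plan: p is the mass sent from the atom xi l to its
   j-th destination and q is p times the displacement. In these variables the
   transport problem with h = max_j min_i (affine) is a bilinear saddle point:
   the plans satisfying the marginal and cost constraints form a compact convex
   set, the multipliers are (gamma, theta) with gamma >= 0 and theta in a simplex,
   and for fixed multipliers the maximum of the Lagrangian over the plans is the
   dual objective minimised over lambda and s. A minimax theorem with one compact
   side therefore gives an optimal plan without any Slater condition, so that
   eps_k = 0 needs no special treatment. Such a plan may carry recession
   directions (p = 0, q <> 0); a small perturbation makes all masses positive and
   turns it into a genuine discrete coupling. Cases (i) and (ii) are those where
   i, respectively j, ranges over a singleton. *)

Require Import Defs.
From HB Require Import structures.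
From mathcomp Require Import all_boot all_order all_algebra.
From mathcomp Require Import all_classical all_reals all_analysis.
From mathcomp Require Import measurable_realfun ring lra.
Set Implicit Arguments.
Unset Strict Implicit.
Unset Printing Implicit Defensive.
Import Order.TTheory GRing.Theory Num.Theory.
Import numFieldNormedType.Exports VectorInternalTheory.
Local Open Scope classical_set_scope.
Local Open Scope ring_scope.

(** * Sublinear functions and norms in finite dimension *)

(** Linear forms, norms and their composites with linear maps are all of this kind. Plans will be
    constrained by inequalities [g x <= c] with sublinear [g], so that closedness and convexity each
    need one argument only. *)
Record sublinear (R : realType) (V : lmodType R) (g : V -> R) : Prop :=
  Sublinear {
    sublinearD : forall x y, g (x + y) <= g x + g y ;
    sublinearZ : forall a x, 0 <= a -> g (a *: x) = a * g x }.

Section sublinear_theory.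
Variables (R : realType) (V : lmodType R).
Implicit Types g h : V -> R.

Lemma sublinear0 g : sublinear g -> g 0 = 0.
Proof. by move=> sg; rewrite -(scale0r 0) (sublinearZ sg)// mul0r. Qed.

Lemma is_norm_sublinear g : is_norm g -> sublinear g.
Proof.
by move=> ng; split=> [x y|a x a0]; rewrite ?(is_normD ng)// (is_normZ ng) ger0_norm.
Qed.

Lemma is_norm0 g : is_norm g -> g 0 = 0.
Proof. by move=> /is_norm_sublinear/sublinear0. Qed.

Lemma scalar_sublinear g : scalar g -> sublinear g.
Proof.
move=> lg.
have g0 : g 0 = 0 by have := lg (-1) 0 0; rewrite scaler0 add0r mulN1r; lra.
split=> [x y|a x _]; first by have := lg 1 x y; rewrite scale1r mul1r => ->.
by have := lg a x 0; rewrite !addr0 g0 addr0.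
Qed.

Lemma sublinear_sum_le g (I : finType) (x : I -> V) : sublinear g ->
  g (\sum_i x i) <= \sum_i g (x i).
Proof.
move=> sg; elim/big_ind2 : _ => [|a b c e ab ce|//]; first by rewrite sublinear0.
exact: le_trans (sublinearD sg _ _) (lerD ab ce).
Qed.

Lemma sublinear_comp (W : lmodType R) (f : {linear W -> V}) g :
  sublinear g -> sublinear (g \o f).
Proof.
move=> sg; split=> [x y|a x a0] /=; first by rewrite linearD sublinearD.
by rewrite linearZ sublinearZ.
Qed.

Lemma sublinear_bigsum (I : finType) (g : I -> V -> R) :
  (forall i, sublinear (g i)) -> sublinear (fun x => \sum_i g i x).
Proof.
move=> sg; split=> [x y|a x a0].
  by rewrite -big_split/=; apply: ler_sum => i _; exact: sublinearD (sg i) _ _.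
by rewrite mulr_sumr; apply: eq_bigr => i _; exact: sublinearZ (sg i) _ _ a0.
Qed.

Lemma sublinear_scale g c : 0 <= c -> sublinear g -> sublinear (fun x => c * g x).
Proof.
move=> c0 sg; split=> [x y|a x a0]; last by rewrite (sublinearZ sg)// mulrCA.
by rewrite -mulrDr ler_wpM2l// (sublinearD sg).
Qed.

End sublinear_theory.

(** Expanding [x] in the matrix units, subadditivity leaves only the values of [g] at plus and minus
    each unit, weighted by coordinates that the sup norm dominates. *)
Lemma sublinear_le_mxnorm (R : realType) m n (g : 'M[R]_(m, n) -> R) :
  sublinear g -> exists2 c, 0 <= c & forall x, g x <= c * `|x|.
Proof.
move=> sg.
pose k ij := Num.max (g (delta_mx ij.1 ij.2)) (g (- delta_mx ij.1 ij.2)).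
exists (\sum_ij `|k ij|) => [|x]; first exact: sumr_ge0.
rewrite [in leLHS](matrix_sum_delta x) pair_bigA/=.
apply: (le_trans (sublinear_sum_le _ sg)).
rewrite mulr_suml; apply: ler_sum => -[i j] _ /=.
have xij : `|x i j| <= `|x|.
  rewrite [leRHS]/Num.norm/= mx_normrE.
  exact: (le_bigmax _ (fun ij : 'I_m * 'I_n => `|x ij.1 ij.2|) (i, j)).
apply: (@le_trans _ _ (`|k (i, j)| * `|x i j|)); last exact: ler_wpM2l.
have [x0|x0] := lerP 0 (x i j).
  rewrite (sublinearZ sg)// (ger0_norm x0) mulrC ler_wpM2r//.
  by apply: le_trans (ler_norm _); rewrite le_max lexx.
have Nx0 : 0 <= - x i j by rewrite oppr_ge0 ltW.
rewrite -[X in g X]opprK -scalerN -scaleNr (sublinearZ sg)//.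
rewrite (ltr0_norm x0) mulrC ler_wpM2r//.
by apply: le_trans (ler_norm _); rewrite le_max lexx orbT.
Qed.

(** Subadditivity bounds [g x - g y] by [g (x - y)] and symmetrically, so the linear bound makes [g]
    Lipschitz. *)
Lemma sublinear_continuous (R : realType) m n (g : 'M[R]_(m, n) -> R) :
  sublinear g -> continuous g.
Proof.
move=> sg x; have [c c0 gc] := sublinear_le_mxnorm sg.
apply/(@cvgrPdist_le _ _ _ _ (nbhs_filter x)) => e e0.
have c1 : 0 < c + 1 by lra.
apply/nbhs_ballP; exists (e / (c + 1)) => /=; first by rewrite divr_gt0.
move=> y; rewrite -ball_normE/= => /ltW xy.
have gxy : g x - g y <= c * `|x - y|.
  by apply: le_trans (gc _); have := sublinearD sg (x - y) y; rewrite subrK; lra.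
have gyx : g y - g x <= c * `|x - y|.
  rewrite distrC; apply: le_trans (gc _).
  by have := sublinearD sg (y - x) x; rewrite subrK; lra.
have cxy : c * `|x - y| <= e.
  apply: (le_trans (ler_wpM2l c0 xy)).
  by rewrite mulrA ler_pdivrMr//; nra.
by rewrite ler_norml; lra.
Qed.

(* Minimising the continuous norm p over the compact unit sphere of the sup norm. *)
Lemma mxnorm_le_is_norm (R : realType) n (p : 'rV[R]_n -> R) :
  is_norm p -> exists2 c, 0 <= c & forall x, `|x| <= c * p x.
Proof.
move=> np.
pose S := [set x : 'rV[R]_n | `|x| = 1].
(* An empty sphere means that the space is trivial. *)
have [[x0 Sx0]|S0] := pselect (S !=set0); last first.
  exists 0 => // x; rewrite mul0r normr_le0; apply/eqP; apply: contrapT => x0.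
  apply: S0; exists (`|x|^-1 *: x); rewrite /S/= normrZ normfV normr_id mulVf//.
  by rewrite normr_eq0; exact/eqP.
have cp : continuous p by exact/sublinear_continuous/is_norm_sublinear.
have cS : compact S.
  apply: bounded_closed_compact.
    by exists 1; split => // y y1 z /= ->; exact: ltW.
  have -> : S = Num.norm @^-1` [set 1 : R] by [].
  apply: closed_comp; last exact: closed_eq.
  by move=> x _; exact: norm_continuous.
have [c] : exists2 c, c \in S & forall t, t \in S -> p c <= p t.
  apply: EVT_min_rV => //; first by exists x0.
  exact: continuous_subspaceT.
rewrite inE => Sc cmin.
have pc : 0 < p c.
  rewrite lt_neqAle (is_norm_ge0 np) andbT eq_sym; apply/eqP => /(is_norm_eq0 np).
  by move=> c0; move: Sc; rewrite /S/= c0 normr0 => /eqP; rewrite eq_sym oner_eq0.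
exists (p c)^-1 => [|x]; first by rewrite invr_ge0 ltW.
have [->|x0'] := eqVneq x 0; first by rewrite normr0 (is_norm0 np) mulr0.
have nx : 0 < `|x| by rewrite normr_gt0.
have /cmin : `|x|^-1 *: x \in S.
  by rewrite inE /S/= normrZ normfV normr_id mulVf// gt_eqF.
rewrite (is_normZ np) normfV normr_id [X in _ <= X -> _]mulrC ler_pdivlMr// => h.
by rewrite mulrC ler_pdivlMr// mulrC.
Qed.

Lemma sublinear_le_is_norm (R : realType) (V : vectType R) (g p : V -> R) :
  sublinear g -> is_norm p -> exists2 c, 0 <= c & forall x, g x <= c * p x.
Proof.
move=> sg np.
have [c1 c10 gc] := sublinear_le_mxnorm (sublinear_comp (@r2v _ V) sg).
have [c2 c20 pc] : exists2 c, 0 <= c &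
    forall x : 'rV[R]_(dim V), `|x| <= c * (p \o @r2v _ V) x.
  apply: mxnorm_le_is_norm; split => [x|x|a x|x y] /=.
  - exact: is_norm_ge0.
  - by move=> /(is_norm_eq0 np) x0; apply: (can_inj r2vK); rewrite x0 linear0.
  - by rewrite linearZ (is_normZ np).
  - by rewrite linearD (is_normD np).
exists (c1 * c2) => [|x]; first exact: mulr_ge0.
have := gc (v2r x); rewrite /= v2rK => /le_trans; apply.
rewrite -mulrA ler_wpM2l//; have := pc (v2r x).
by rewrite /= v2rK.
Qed.

(** * Minimax over a compact convex set *)

Section compact_minimax.
Variables (R : realType) (n : nat) (K : set 'rV[R]_n) (Y : Type).
Variables (F : 'rV[R]_n -> Y -> R) (v : R).
Hypothesis cptK : compact K.
Hypothesis convK : forall x y t, K x -> K y -> 0 <= t <= 1 ->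
  K (x + t *: (y - x)).
Hypothesis linF : forall y, scalar (F^~ y).

Let contF y : continuous (F^~ y).
Proof. exact/sublinear_continuous/scalar_sublinear. Qed.

Let FD x z t y : F (x + t *: (z - x)) y = F x y + t * (F z y - F x y).
Proof.
by rewrite addrC linF addrC; congr (_ + t * _); rewrite addrC -scaleN1r linF mulN1r addrC.
Qed.

(* First-order condition at a minimiser of the squared distance to the orthant
   [v, +oo[^N: the residuals w are the coefficients of a separating hyperplane. *)
Lemma orthant_separation (N : nat) (ys : 'I_N -> Y) : K !=set0 ->
  (forall x, K x -> exists i, F x (ys i) < v) ->
  exists w : 'I_N -> R, [/\ forall i, 0 <= w i, 0 < \sum_i w i &
    forall x, K x -> \sum_i w i * F x (ys i) < v * \sum_i w i].
Proof.
move=> K0 Fv.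
pose pos (a : R) := Num.max 0 a.
pose phi x := \sum_i pos (v - F x (ys i)) ^+ 2.
have cphi : continuous phi.
  apply: continuous_big; first exact: add_continuous.
  move=> i _ x.
  have cpos : continuous (fun z : R => pos (v - z)).
    move=> z; apply: (@continuous_max _ _ (cst 0) (fun z => v - z) z).
      exact: cvg_cst.
    by apply: cvgB; [exact: cvg_cst|exact: cvg_id].
  apply: (@continuous_comp _ _ _ (F^~ (ys i)) (fun z : R => pos (v - z) ^+ 2)).
    exact: contF.
  exact: (cvgM (cpos _) (cpos _)).
have [x0] : exists2 c, c \in K & forall t, t \in K -> phi c <= phi t.
  by apply: EVT_min_rV => //; exact: continuous_subspaceT.
rewrite inE => Kx0 minx0.
pose w i := pos (v - F x0 (ys i)).
have w0 i : 0 <= w i by rewrite /w/pos le_max lexx.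
have ww i : w i * F x0 (ys i) = w i * v - w i ^+ 2.
  by rewrite /w/pos; case: (lerP 0 (v - F x0 (ys i))) => _; ring.
have [i0 i0v] := Fv _ Kx0.
have wi0 : 0 < w i0 by rewrite /w/pos lt_max subr_gt0 i0v orbT.
exists w; split => //.
  by rewrite (bigD1 i0)//= ltr_pwDl// sumr_ge0.
move=> x Kx.
pose D i := F x (ys i) - F x0 (ys i).
(* The derivative of [phi] at [x0] along [x - x0] is minus twice this sum, and minimality makes it
   nonnegative. *)
suff wD : \sum_i w i * D i <= 0.
  have -> : \sum_i w i * F x (ys i) =
      \sum_i w i * D i + (v * \sum_i w i - \sum_i w i ^+ 2).
    rewrite mulr_sumr -sumrB -big_split/=; apply: eq_bigr => i _.
    by rewrite /D mulrBr ww; ring.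
  have : 0 < \sum_i w i ^+ 2.
    by rewrite (bigD1 i0)//= ltr_pwDl ?exprn_gt0// sumr_ge0// => i _; exact: sqr_ge0.
  lra.
set S := \sum_i _; pose T := \sum_i D i ^+ 2.
have T0 : 0 <= T by apply: sumr_ge0 => i _; exact: sqr_ge0.
(* Along the segment [phi] exceeds its linearisation at [x0] by at most [t ^+ 2 * T]. *)
have St t : 0 <= t <= 1 -> 0 < t -> 2 * S <= t * T.
  move=> t01 t0.
  have /minx0 : x0 + t *: (x - x0) \in K by rewrite inE; exact: convK.
  have : phi (x0 + t *: (x - x0)) <= phi x0 - 2 * t * S + t ^+ 2 * T.
    rewrite /phi /S /T 2!mulr_sumr -sumrB -big_split/=; apply: ler_sum => i _.
    rewrite FD -/(D i) /w /pos.
    case: (lerP 0 (v - F x0 (ys i))) => a0;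
      case: (lerP 0 (v - (F x0 (ys i) + t * D i))) => b0; nra.
  by move=> h1 h2; rewrite -(ler_pM2l t0); lra.
rewrite leNgt; apply/negP => S0.
have ST : 0 < S + T + 1 by lra.
(* This step length [t] satisfies [t * T < S], which contradicts [St]. *)
have t0 : 0 < S / (S + T + 1) by rewrite divr_gt0.
have /St/(_ t0) : 0 <= S / (S + T + 1) <= 1.
  by rewrite ltW//= ler_pdivrMr//; lra.
by rewrite mulrAC ler_pdivlMr//; nra.
Qed.

(** If no [x] works, the open sets where [F x y < v] cover [K]. A finite subcover and the separating
    weights give a mixed [y] with [F x y < v] on all of [K], a contradiction. On the side of [Y],
    convexity is expressed by mixing alone, without topology. *)
Lemma compact_minimax :
  (forall (N : nat) (w : 'I_N -> R) (ys : 'I_N -> Y),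
    (forall i, 0 <= w i) -> \sum_i w i = 1 ->
    exists y, forall x, F x y = \sum_i w i * F x (ys i)) ->
  Y -> (forall y, exists2 x, K x & v <= F x y) ->
  exists2 x, K x & forall y, v <= F x y.
Proof.
move=> mixY y0 Fv; apply: contrapT => noF.
have {}noF x : K x -> exists y, F x y < v.
  move=> Kx; apply: contrapT => noy; apply: noF; exists x => // y.
  by rewrite leNgt; apply/negP => Fy; apply: noy; exists y.
move: (cptK); rewrite compact_cover.
(* [{classic Y}] provides the choice structure that a finite subcover indexed by [Y] requires. *)
move=> /(_ {classic Y} setT (fun y => [set x | F x y < v]))[||D _ KD].
- move=> y _; apply: (@open_comp _ _ (F^~ y) [set z | z < v]); last exact: open_lt.
  by move=> x _; exact: contF.
- by move=> x /noF[y Fy]; exists y.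
pose E : seq {classic Y} := finmap.enum_fset D.
pose ys (i : 'I_(size E)) := nth (y0 : {classic Y}) E i.
have [x1 Kx1 _] := Fv y0.
have [|x Kx|w [w0 W0 wF]] := @orthant_separation _ ys.
- by exists x1.
- have [y Dy Fy] := KD _ Kx.
  have yD : (index y E < size E)%N by rewrite index_mem.
  by exists (Ordinal yD); rewrite /ys/= nth_index.
pose W := \sum_i w i.
have [i||y Fy] := mixY _ (fun i => w i / W) ys.
- by rewrite divr_ge0// ltW.
- by rewrite -mulr_suml mulfV// gt_eqF.
have [x Kx] := Fv y; rewrite Fy leNgt => /negP; apply.
have -> : \sum_i w i / W * F x (ys i) = (\sum_i w i * F x (ys i)) / W.
  by rewrite mulr_suml; apply: eq_bigr => i _; rewrite mulrAC.
by rewrite ltr_pdivrMr//; exact: wF.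
Qed.

End compact_minimax.

Section sublinear_polytope_minimax.
Variables (R : realType) (V : vectType R) (I Y : Type).
Variables (g : I -> V -> R) (c : I -> R) (p : V -> R) (B : R).
Variables (F : V -> Y -> R) (v : R).
Hypothesis sg : forall i, sublinear (g i).
Hypothesis np : is_norm p.
Let K := [set x | forall i, g i x <= c i].
Hypothesis bK : forall x, K x -> p x <= B.
Hypothesis linF : forall y, scalar (F^~ y).

(** In coordinates [K] is closed and convex as an intersection of sublevel sets of sublinear
    functions, and the bound on the norm [p] makes it compact. *)
Lemma sublinear_minimax :
  (forall (N : nat) (w : 'I_N -> R) (ys : 'I_N -> Y),
    (forall i, 0 <= w i) -> \sum_i w i = 1 ->
    exists y, forall x, F x y = \sum_i w i * F x (ys i)) ->
  Y -> (forall y, exists2 x, K x & v <= F x y) ->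
  exists2 x, K x & forall y, v <= F x y.
Proof.
move=> mixY y0 Fv.
pose K' := [set x : 'rV[R]_(dim V) | K (r2v x)].
have sg' i : sublinear (g i \o @r2v _ V) by exact: sublinear_comp.
have cK' : closed K'.
  have -> : K' = \bigcap_(i in setT) [set x | (g i \o @r2v _ V) x <= c i].
    by apply/seteqP; split=> [x Kx i _|x Kx i]; exact: Kx.
  apply: closed_bigI => i _.
  apply: (@closed_comp _ _ (g i \o @r2v _ V) [set z | z <= c i]).
    by move=> x _; exact: sublinear_continuous.
  exact: closed_le.
have cptK' : compact K'.
  apply: bounded_closed_compact => //.
  have snorm : sublinear (fun x : V => `|v2r x|).
    by split=> [x y|a x a0]; rewrite ?linearD ?ler_normD// linearZ normrZ ger0_norm.
  have [b b0 nb] := sublinear_le_is_norm snorm np.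
  exists (b * B); split; first by rewrite num_real.
  move=> y By z Kz; rewrite /= -(r2vK z); apply: (le_trans (nb _)).
  apply: le_trans (ltW By); apply: ler_wpM2l => //; exact: bK.
have [||y a x z|||y|x Kx xF] := @compact_minimax R (dim V) K' Y (fun x y => F (r2v x) y) v.
- exact: cptK'.
- move=> x y t Kx Ky /andP[t0 t1] i.
  have -> : r2v (x + t *: (y - x)) = (1 - t) *: r2v x + t *: r2v y :> V.
    by rewrite linearD linearZ linearB/= scalerBr scalerBl scale1r addrA addrAC.
  apply: (le_trans (sublinearD (sg i) _ _)).
  rewrite !(sublinearZ (sg i))// ?subr_ge0//.
  by have := Kx i; have := Ky i; rewrite /=; nra.
- by rewrite linearD linearZ; exact: linF.
- move=> N w ys w0 w1; have [y Fy] := mixY N w ys w0 w1.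
  by exists y => x; rewrite Fy.
- by [].
- have [x Kx vF] := Fv y; exists (v2r x); rewrite ?v2rK//.
  by rewrite /K'/= v2rK.
by exists (r2v x).
Qed.

End sublinear_polytope_minimax.

(** * Inner products and dual norms *)

Section dot_theory.
Variable R : realType.

Lemma dotE n (u v : 'cV[R]_n) : dot u v = (u^T *m v) 0 0.
Proof. by rewrite mxE; apply: eq_bigr => i _; rewrite mxE. Qed.

Lemma dotC n (u v : 'cV[R]_n) : dot u v = dot v u.
Proof. by apply: eq_bigr => i _; rewrite mulrC. Qed.

Lemma dotDr n (u v w : 'cV[R]_n) : dot u (v + w) = dot u v + dot u w.
Proof. by rewrite !dotE mulmxDr mxE. Qed.

Lemma dotZr n (u v : 'cV[R]_n) a : dot u (a *: v) = a * dot u v.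
Proof. by rewrite !dotE -scalemxAr mxE. Qed.

Lemma dotNr n (u v : 'cV[R]_n) : dot u (- v) = - dot u v.
Proof. by rewrite -scaleN1r dotZr mulN1r. Qed.

Lemma dotBr n (u v w : 'cV[R]_n) : dot u (v - w) = dot u v - dot u w.
Proof. by rewrite dotDr dotNr. Qed.

Lemma dot0r n (u : 'cV[R]_n) : dot u 0 = 0.
Proof. by rewrite -(scale0r 0) dotZr mul0r. Qed.

Lemma dotZl n (u v : 'cV[R]_n) a : dot (a *: v) u = a * dot v u.
Proof. by rewrite !(dotC _ u) dotZr. Qed.

Lemma dotBl n (u v w : 'cV[R]_n) : dot (v - w) u = dot v u - dot w u.
Proof. by rewrite !(dotC _ u) dotBr. Qed.

Lemma dot_suml n (I : finType) (v : I -> 'cV[R]_n) u :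
  dot (\sum_i v i) u = \sum_i dot (v i) u.
Proof. by rewrite dotE linear_sum mulmx_suml summxE; apply: eq_bigr => i _; rewrite dotE. Qed.

Lemma dot_trmxl m n (A : 'M[R]_(m, n)) u v : dot (A^T *m u) v = dot u (A *m v).
Proof. by rewrite !dotE trmx_mul trmxK mulmxA. Qed.

Lemma dot_ge0 n (u v : 'cV[R]_n) : cle 0 u -> cle 0 v -> 0 <= dot u v.
Proof.
move=> u0 v0; apply: sumr_ge0 => i _.
by have := v0 i; have := u0 i; rewrite mxE; exact: mulr_ge0.
Qed.

Lemma dot_scalar n (u : 'cV[R]_n) : scalar (dot u).
Proof. by move=> a x y; rewrite dotDr dotZr. Qed.

Lemma dot_submxcol n (d : 'I_n -> nat) (z x : 'cV[R]_(\sum_(k < n) d k)) :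
  dot z x = \sum_k dot (submxcol z k) (submxcol x k).
Proof.
rewrite dotE -{1}(submxcolK z) -{1}(submxcolK x) tr_mxcol mul_mxrow_mxcol summxE.
by apply: eq_bigr => k _; rewrite dotE.
Qed.

End dot_theory.

Section dual_norm_theory.
Variables (R : realType) (n : nat) (N : 'cV[R]_n -> R).
Hypothesis nN : is_norm N.

(** A linear form is bounded on the unit ball of any norm in finite dimension, so [sup] is a true
    supremum here. *)
Let dual_has_sup z : has_sup [set dot z x | x in [set x | N x <= 1]].
Proof.
split; first by exists (dot z 0), 0 => //=; rewrite (is_norm0 nN).
have [c c0 zc] := sublinear_le_is_norm (scalar_sublinear (dot_scalar z)) nN.
exists c => _ [x /= x1 <-]; apply: (le_trans (zc x)).
by rewrite ler_piMr.
Qed.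

Lemma dual_norm_ge0 z : 0 <= dual_norm N z.
Proof.
have -> : 0 = dot z 0 by rewrite dot0r.
apply: sup_upper_bound; first exact: dual_has_sup.
by exists 0 => //=; rewrite (is_norm0 nN).
Qed.

Lemma dot_le_dual_norm z x : dot z x <= dual_norm N z * N x.
Proof.
have [->|x0] := eqVneq x 0; first by rewrite dot0r (is_norm0 nN) mulr0.
have Nx : 0 < N x.
  rewrite lt_neqAle (is_norm_ge0 nN) andbT eq_sym.
  by apply: contraNneq x0 => /(is_norm_eq0 nN)/eqP.
rewrite -ler_pdivrMr// mulrC -dotZr; apply: sup_upper_bound.
  exact: dual_has_sup.
exists ((N x)^-1 *: x) => //=.
by rewrite (is_normZ nN) gtr0_norm ?invr_gt0// mulVf// gt_eqF.
Qed.

(** A near-maximiser on the unit ball; the loss [e] is later absorbed into the tolerance on the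
    duality gap. *)
Lemma dual_norm_approx z e : 0 < e ->
  exists2 x, N x <= 1 & dual_norm N z - e < dot z x.
Proof.
by move=> e0; have [_ [x x1 <-] zx] := sup_adherent e0 (dual_has_sup z); exists x.
Qed.

End dual_norm_theory.

(** * Discrete measures and integrals over couplings *)

Section discrete_measures.
Context d (T : measurableType d) (R : realType) (I : Type).
Import HBNNSimple.
Variables (w : I -> R) (y : I -> T).
Hypothesis w0 : forall i, 0 <= w i.
Local Open Scope ereal_scope.

(** The measure and its integral formula are built together, one scaled Dirac mass at a time. *)
Let discrete_measure_exists_integral (s : seq I) :
  exists mu : {measure set T -> \bar R},
    (forall A, mu A = \sum_(i <- s) (w i)%:E * \d_(y i) A) /\
    forall f : T -> \bar R, (forall x, 0 <= f x) -> measurable_fun setT f ->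
      \int[mu]_x f x = \sum_(i <- s) (w i)%:E * f (y i).
Proof.
elim: s => [|i s [mu [muE muI]]].
  exists mzero; split => [A|f _ _]; rewrite big_nil//.
  exact: integral_measure_zero.
exists (measure_add (mscale (NngNum (w0 i)) \d_(y i)) mu); split.
  move=> A; rewrite big_cons -muE.
  exact: (measure_addE (mscale (NngNum (w0 i)) \d_(y i)) mu A).
move=> f f0 mf; rewrite ge0_integral_measure_add// muI// big_cons.
rewrite ge0_integral_mscale// integral_dirac//=.
by rewrite diracT mul1e.
Qed.

Lemma discrete_measure_exists (s : seq I) :
  exists mu : {measure set T -> \bar R},
    forall A, mu A = \sum_(i <- s) (w i)%:E * \d_(y i) A.
Proof.
by have [mu [muE _]] := discrete_measure_exists_integral s; exists mu.
Qed.

Lemma discrete_probability_exists (s : seq I) : (\sum_(i <- s) w i = 1)%R ->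
  exists P : probability T R,
    forall A, P A = \sum_(i <- s) (w i)%:E * \d_(y i) A.
Proof.
move=> w1; have [mu muE] := discrete_measure_exists s.
have mu1 : mu setT = 1.
  rewrite muE; under eq_bigr do rewrite diracT mule1.
  by rewrite sumEFin w1.
(* Normalising supplies the probability structure and changes nothing, the total mass being 1; the
   fallback [dirac point] is never reached. *)
have nE A : (mnormalize mu (dirac point) : set T -> \bar R) A = mu A.
  by rewrite /mnormalize mu1 onee_eq0/= invr1 mule1.
by exists (mnormalize mu (dirac point)) => A; rewrite -muE -nE.
Qed.

Section integral.
Variables (s : seq I) (mu : {measure set T -> \bar R}).
Hypothesis muE :
  forall A, measurable A -> mu A = \sum_(i <- s) (w i)%:E * \d_(y i) A.

Lemma ge0_integral_discrete (f : T -> \bar R) : (forall x, 0 <= f x) ->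
  measurable_fun setT f -> \int[mu]_x f x = \sum_(i <- s) (w i)%:E * f (y i).
Proof.
move=> f0 mf; have [nu [nuE nuI]] := discrete_measure_exists_integral s.
rewrite -nuI//; apply: eq_measure_integral => A mA _.
by rewrite muE// nuE.
Qed.

(* No measurability of f is needed: the simple functions below f are bounded by
   f at the atoms. *)
Lemma ge0_integral_discrete_le (f : T -> \bar R) : (forall x, 0 <= f x) ->
  \int[mu]_x f x <= \sum_(i <- s) (w i)%:E * f (y i).
Proof.
move=> f0; rewrite ge0_integralTE//; apply: ge_ereal_sup => _ [h /= hf <-].
rewrite -integralT_nnsfun ge0_integral_discrete//; last first.
- by apply/measurable_EFinP; exact: measurable_funPT.
- by move=> x; rewrite lee_fin; exact: fun_ge0.
apply: lee_sum => i _; apply: lee_wpmul2l; first by rewrite lee_fin.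
exact: hf.
Qed.

Lemma integral_discrete (f : T -> R) : measurable_fun setT f ->
  \int[mu]_x (f x)%:E = (\sum_(i <- s) w i * f (y i))%:E.
Proof.
move=> mf; rewrite integralE.
have mEf : measurable_fun setT (EFin \o f) by exact/measurable_EFinP.
rewrite ge0_integral_discrete//; last exact: measurable_funepos.
rewrite ge0_integral_discrete//; last exact: measurable_funeneg.
have -> : \sum_(i <- s) (w i)%:E * (EFin \o f)^\+ (y i) =
    (\sum_(i <- s) w i * Num.max (f (y i)) 0)%:E.
  by rewrite -sumEFin; apply: eq_bigr => i _; rewrite funeposE/= -EFin_max EFinM.
have -> : \sum_(i <- s) (w i)%:E * (EFin \o f)^\- (y i) =
    (\sum_(i <- s) w i * Num.max (- f (y i)) 0)%:E.
  by rewrite -sumEFin; apply: eq_bigr => i _; rewrite funenegE/= -EFin_max EFinM.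
rewrite -EFinB -sumrB; congr EFin; apply: eq_bigr => i _; rewrite -mulrBr.
by congr (_ * _)%R; case: leP => ?; case: leP => ?; lra.
Qed.

End integral.
End discrete_measures.

Section integral_comparison.
Context d (T : measurableType d) (R : realType).
Variable mu : {measure set T -> \bar R}.
Local Open Scope ereal_scope.

(** The integral is the supremum over the simple functions below, a family that grows with the
    function. This serves transport costs, whose measurability is given only in the second argument,
    at the atoms. *)
Lemma ge0_le_integral_nonmeasurable (f g : T -> \bar R) :
  (forall x, 0 <= f x) -> (forall x, f x <= g x) ->
  \int[mu]_x f x <= \int[mu]_x g x.
Proof.
move=> f0 fg; have g0 x : 0 <= g x by exact: le_trans (fg x).
rewrite !ge0_integralTE//; apply: ereal_sup_le => _ [h /= hf <-].
by exists h => // x; exact: le_trans (fg x).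
Qed.

(** The integral of [f] may be minus infinity; positive and negative parts are compared
    separately. *)
Lemma ae_le_integral (f g : T -> \bar R) :
  measurable_fun setT f -> mu.-integrable setT g ->
  {ae mu, forall x, f x <= g x} -> \int[mu]_x f x <= \int[mu]_x g x.
Proof.
move=> mf ig fg; have mg := measurable_int mu ig.
rewrite integralE [leRHS]integralE; apply: leeB.
- apply: ae_ge0_le_integral => //; [exact: measurable_funepos..|].
  apply: filterS fg => x fgx _; rewrite !funeposE ge_max le_max fgx/=.
  by rewrite le_max lexx orbT.
- apply: ae_ge0_le_integral => //; [exact: measurable_funeneg..|].
  apply: filterS fg => x fgx _; rewrite !funenegE ge_max le_max leeN2 fgx/=.
  by rewrite le_max lexx orbT.
Qed.

Lemma integral_pushforward_nonintegrable d' (U : measurableType d')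
  (phi : T -> U) (nu : {measure set U -> \bar R}) (f : U -> \bar R) :
  measurable_fun setT phi ->
  (forall A, measurable A -> pushforward mu phi A = nu A) ->
  measurable_fun setT f ->
  \int[nu]_x f x = \int[mu]_x f (phi x).
Proof.
move=> mphi pE mf.
pose phi' : {mfun T >-> U} := HB.pack phi (isMeasurableFun.Build _ _ _ _ _ mphi).
have ge0 g : (forall x, 0 <= g x) -> measurable_fun setT g ->
    \int[nu]_x g x = \int[mu]_x g (phi x).
  move=> g0 mg; rewrite -[RHS](@ge0_integral_pushforward _ _ _ _ _ _ mphi mu setT g)//.
  apply: (@eq_measure_integral _ U R setT (pushforward mu phi')).
  by move=> A mA _; rewrite -pE.
rewrite integralE ge0//; last exact: measurable_funepos.
rewrite ge0//; last exact: measurable_funeneg.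
rewrite [RHS]integralE.
have -> : (fun x => f (phi x))^\+ = f^\+ \o phi := funepos_comp f phi.
by have -> : (fun x => f (phi x))^\- = f^\- \o phi := funeneg_comp f phi.
Qed.

End integral_comparison.

(** * Upper bound on the expectation along a coupling *)

Section transport_bound.
Context d (T : measurableType d) (R : realType) (M n : nat).
Variables (l0 : 'I_M) (xi : 'I_M -> T) (vartheta : 'I_M -> R).
Hypothesis vartheta_ge0 : forall l, 0 <= vartheta l.
Variables (Q P : probability T R) (pi : probability (T * T)%type R) (Xi : set T).
Hypothesis QE : forall A, measurable A ->
  Q A = (\sum_(l < M) (vartheta l)%:E * \d_(xi l) A)%E.
Hypothesis mxi : forall l, measurable [set xi l].
Hypothesis mXi : measurable Xi.
Hypothesis piXi : pi (Xi `*` Xi) = 1%E.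
Hypothesis pi1 : forall A, measurable A -> pushforward pi fst A = Q A.
Hypothesis pi2 : forall A, measurable A -> pushforward pi snd A = P A.
Variables (c : 'I_n -> T -> T -> R) (eps : 'I_n -> R).
Hypothesis c0 : forall k x y, 0 <= c k x y.
Hypothesis mc : forall k l, measurable_fun setT (c k (xi l)).
Hypothesis ceps : forall k, (\int[pi]_w (c k w.1 w.2)%:E <= (eps k)%:E)%E.

(* The atoms may repeat: rho picks, at each atom x, the cheapest index l with
   xi l = x, so that [atomwise] is well defined as a function of the point. *)
Lemma transport_integral_le (h : T -> R) (lam : 'I_n -> R) (s : 'I_M -> R) :
  measurable_fun setT h -> (forall k, 0 <= lam k) ->
  (forall l y, Xi y -> h y <= s l + \sum_k lam k * c k (xi l) y) ->
  (\int[P]_x (h x)%:E <=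
    (\sum_k lam k * eps k + \sum_l vartheta l * s l)%:E)%E.
Proof.
move=> mh lam0 hs.
have /choice[rho rhoP] x : exists l, forall l', xi l' = x ->
    xi l = x /\ s l <= s l'.
  have [[l1 l1x]|nox] := pselect (exists l, xi l = x); last first.
    by exists l0 => l' l'x; case: nox; exists l'.
  have Pl1 : [pred l | `[< xi l = x >]] l1 by apply/asboolP.
  case: (@Order.TotalTheory.arg_minP _ _ _ l1 [pred l | `[< xi l = x >]] s Pl1).
  move=> l /= /asboolP lx lmin; exists l => l' l'x; split=> //.
  by apply: lmin; apply/asboolP.
pose atomwise (g : 'I_M -> R) x :=
  \sum_(l < M) (rho (xi l) == l)%:R * \1_[set xi l] x * g l.
have atomwiseE g l : atomwise g (xi l) = g (rho (xi l)).
  have [xil _] := rhoP _ l erefl.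
  rewrite /atomwise (bigD1 (rho (xi l)))//= xil eqxx indicE mem_set//= !mul1r.
  rewrite big1 ?addr0// => l' l'l; rewrite indicE.
  case: eqP => [l'E|]; last by rewrite !mul0r.
  rewrite memNset ?mulr0 ?mul0r//= => xl.
  by move: l'l; rewrite -l'E -xl eqxx.
have atomwise0 g x : (forall l, xi l <> x) -> atomwise g x = 0.
  move=> nox; rewrite /atomwise big1// => l _.
  by rewrite indicE memNset ?mulr0 ?mul0r//= => xl; exact: (nox l).
pose S := atomwise s.
have mS : measurable_fun setT S.
  apply: measurable_sum => l; apply: measurable_funM => //.
  by apply: measurable_funM => //; exact: measurable_indic.
(* A jointly measurable substitute for the cost: equal to it when the first coordinate is an atom,
   and 0 otherwise. *)
pose C k (w : T * T) := atomwise (fun l => c k (xi l) w.2) w.1.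
have C0 k w : 0 <= C k w.
  by apply: sumr_ge0 => l _; rewrite !mulr_ge0.
have Cc k w : C k w <= c k w.1 w.2.
  have [[l lw]|now] := pselect (exists l, xi l = w.1).
    rewrite /C -lw atomwiseE; have [xil _] := rhoP _ l erefl.
    by rewrite xil.
  by rewrite /C atomwise0// => l lw; apply: now; exists l.
have mC k : measurable_fun setT (C k).
  apply: measurable_sum => l; apply: measurable_funM.
    apply: measurable_funM => //.
    have mI : measurable_fun setT (\1_[set xi l] : T -> R).
      exact: measurable_indic.
    exact: measurableT_comp mI measurable_fst.
  exact: measurableT_comp (mc k l) measurable_snd.
have iS : pi.-integrable setT (fun w => (S w.1)%:E).
  apply: measurable_bounded_integrable => //.
  - exact: le_lt_trans (probability_le1 pi measurableT) (ltry _).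
  - exact: measurableT_comp mS measurable_fst.
  exists (\sum_l `|s l|); split; first exact: num_real.
  move=> B sB w _ /=; apply: le_trans (ltW sB).
  apply: (le_trans (ler_norm_sum _ _ _)); apply: ler_sum => l _.
  rewrite normrM ler_piMl// ger0_norm ?mulr_ge0// mulr_ile1// ?indicE.
  by rewrite lern1 leq_b1.
have iC k : pi.-integrable setT (fun w => (C k w)%:E).
  apply/integrableP; split; first exact/measurable_EFinP.
  apply: (@le_lt_trans _ _ (\int[pi]_w (c k w.1 w.2)%:E)%E).
    apply: ge0_le_integral_nonmeasurable => w; first exact: abse_ge0.
    by rewrite abse_EFin ger0_norm// lee_fin.
  exact: le_lt_trans (ceps k) (ltry _).
rewrite (integral_pushforward_nonintegrable _ pi2)//; last exact/measurable_EFinP.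
apply: (@le_trans _ _
  (\int[pi]_w ((S w.1)%:E + \sum_k (lam k)%:E * (C k w)%:E))%E).
  apply: ae_le_integral.
  - by apply/measurable_EFinP; exact: measurableT_comp mh measurable_snd.
  - apply: integrableD => //; apply: (integrable_sum measurableT) => k _.
    exact: integrableZl.
  (* Almost surely the first coordinate is an atom, by the first marginal, and both coordinates lie
     in [Xi]; there [hs] applies with the index chosen by [rho]. *)
  pose atoms := \bigcup_(l in [set: 'I_M]) [set xi l].
  have matoms : measurable atoms by exact: fin_bigcup_measurable.
  have mX : measurable (Xi `*` Xi) by exact: measurableX.
  have nulla : pi (fst @^-1` (~` atoms)) = 0%E.
    have := pi1 (measurableC matoms); rewrite /pushforward => ->.
    rewrite QE; last exact: measurableC.
    rewrite big1// => l _; rewrite diracE memNset ?mule0//=; apply.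
    by exists l.
  have nullX : pi (~` (Xi `*` Xi)) = 0%E.
    by rewrite (probability_setC pi mX) piXi subee.
  have matoms1 : measurable (fst @^-1` (~` atoms) : set (T * T)).
    rewrite -[X in measurable X]setTI.
    exact: (@measurable_fst _ _ T T measurableT _ (measurableC matoms)).
  exists (fst @^-1` (~` atoms) `|` ~` (Xi `*` Xi)); split.
  - exact: measurableU matoms1 (measurableC mX).
  - exact: null_set_setU matoms1 (measurableC mX) nulla nullX.
  move=> w /= nhw; apply: contrapT => /not_orP[/contrapT[l _ lw] /contrapT[Xw1 Xw2]].
  apply: nhw; under eq_bigr do rewrite -EFinM.
  rewrite sumEFin -EFinD lee_fin; apply: le_trans (hs (rho (xi l)) _ Xw2) _.
  by rewrite /S /C lw atomwiseE lerD2l; apply: ler_sum => k _; rewrite atomwiseE.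
rewrite integralD//; last first.
  by apply: (integrable_sum measurableT) => k _; exact: integrableZl.
rewrite integral_sum//; last by move=> k; exact: integrableZl.
rewrite addeC EFinD; apply: leeD.
  rewrite -sumEFin; apply: lee_sum => k _; rewrite integralZl// EFinM.
  apply: lee_wpmul2l; first by rewrite lee_fin.
  apply: le_trans (ceps k); apply: ge0_le_integral_nonmeasurable => w.
    by rewrite lee_fin.
  by rewrite lee_fin.
(* The first marginal turns the integral of [S] into a sum over atoms of [s (rho (xi l))], which is
   at most [s l] by the choice of [rho]. *)
have mES : measurable_fun setT (EFin \o S) by exact/measurable_EFinP.
rewrite -(integral_pushforward_nonintegrable _ pi1 mES)//.
rewrite (integral_discrete vartheta_ge0 QE mS) lee_fin.
apply: ler_sum => l _; apply: ler_wpM2l => //.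
by rewrite /S atomwiseE; have [] := rhoP _ l erefl.
Qed.

End transport_bound.

(** * Borel measurability of the data *)

Section borelV_measurability.
Variables (R : realType) (D : nat).

Lemma borelV_open (A : set (borelV R D)) : @open 'cV[R]_D A -> measurable A.
Proof. exact: sub_sigma_algebra. Qed.

Lemma borelV_closed (A : set (borelV R D)) : @closed 'cV[R]_D A -> measurable A.
Proof.
move=> cA; rewrite -(setCK A); apply: measurableC.
by apply: borelV_open; exact: (@closed_openC 'cV[R]_D).
Qed.

Lemma borelV_set1 (x : borelV R D) : measurable [set x].
Proof.
apply: borelV_closed; apply: (@accessible_closed_set1 'cV[R]_D).
by apply: hausdorff_accessible; exact: norm_hausdorff.
Qed.

Lemma continuous_measurable_borelV (g : 'cV[R]_D -> R) : continuous g ->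
  measurable_fun setT (g : borelV R D -> R).
Proof.
move=> cg; apply: (@measurability _ _ (borelV R D) R setT g _ (RGenOpens.measurableE R)).
move=> _ [_ [a [b ->]] <-]; rewrite setTI; apply: borelV_open.
apply: open_comp; last exact: interval_open.
by move=> x _; exact: cg.
Qed.

End borelV_measurability.

Lemma polyhedron_closed (R : realType) r D (C : 'M[R]_(r, D)) f :
  closed (polyhedron C f).
Proof.
have -> : polyhedron C f = \bigcap_(i in setT) [set x | dot (row i C)^T x <= f i 0].
  have E i x : dot (row i C)^T x = (C *m x) i 0.
    by rewrite dotE trmxK -row_mul mxE.
  by apply/seteqP; split=> [x Px i _|x Px i]; rewrite -?E; [rewrite /= E|]; exact: Px.
apply: closed_bigI => i _.
apply: (@closed_comp _ _ (dot (row i C)^T) [set z | z <= f i 0]).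
  move=> x _; apply: sublinear_continuous; apply: scalar_sublinear.
  exact: dot_scalar.
exact: closed_le.
Qed.

Lemma affine_continuous (R : realType) D m (alpha : 'I_m -> 'cV[R]_D) b j :
  continuous (affine alpha b j).
Proof.
move=> x; apply: (@continuous_comp _ _ _ (dot (alpha j)) (fun z => z + b j 0)).
  exact/sublinear_continuous/scalar_sublinear/dot_scalar.
by apply: cvgD; [exact: cvg_id|exact: cvg_cst].
Qed.

Section pointwise_duality.
Variables (R : realType) (n : nat) (d : 'I_n -> nat).
Variables (N : forall k : 'I_n, 'cV[R]_(d k) -> R).
Arguments N : clear implicits.
Hypothesis N_norm : forall k, is_norm (N k).
Variables (r : nat) (C : 'M[R]_(r, \sum_(k < n) d k)) (f : 'cV[R]_r).
Variables (I : finType) (alpha : I -> 'cV[R]_(\sum_(k < n) d k)) (b : I -> R).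

(** From [x] to [y], the weighted affine value plus [gamma] against the slack grows by exactly
    [dot z (x - y)]. Dual norms bound this block by block, and the slack term at [y] is
    nonnegative. *)
Lemma affine_le_dual (x y : 'cV[R]_(\sum_(k < n) d k)) (gamma : 'cV[R]_r)
    (theta : I -> R) (s : R) (lambda : 'I_n -> R) :
  polyhedron C f y -> cle 0 gamma ->
  \sum_i theta i * (b i + dot (alpha i) x) + dot gamma (f - C *m x) <= s ->
  (forall k, dual_norm (N k)
    (submxcol (C^T *m gamma - \sum_i theta i *: alpha i) k) <= lambda k) ->
  \sum_i theta i * (dot (alpha i) y + b i)
    <= s + \sum_k lambda k * N k (submxcol (x - y) k).
Proof.
move=> fy g0 xs zl.
set z := C^T *m gamma - \sum_i theta i *: alpha i in zl.
have gy : 0 <= dot gamma (f - C *m y).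
  by apply: dot_ge0 => // i; have := fy i; rewrite !mxE; lra.
have zxy : dot z (x - y) <= \sum_k lambda k * N k (submxcol (x - y) k).
  rewrite dot_submxcol; apply: ler_sum => k _.
  apply: (le_trans (dot_le_dual_norm (N_norm k) _ _)).
  by apply: ler_wpM2r; [exact: is_norm_ge0|exact: zl].
have zE : dot z (x - y) = dot gamma (C *m x) - dot gamma (C *m y)
    - \sum_i theta i * (dot (alpha i) x - dot (alpha i) y).
  rewrite dotBl dot_trmxl mulmxBr (dotBr gamma) dot_suml; congr (_ - _).
  by apply: eq_bigr => i _; rewrite dotZl dotBr.
have tE : \sum_i theta i * (b i + dot (alpha i) x) =
    \sum_i theta i * (dot (alpha i) x - dot (alpha i) y) +
    \sum_i theta i * (dot (alpha i) y + b i).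
  by rewrite -big_split/=; apply: eq_bigr => i _; ring.
move: xs gy; rewrite !dotBr; lra.
Qed.

End pointwise_duality.

(** * Duality for maxima of minima of affine functions *)

Lemma scaler_exchange (R : pzRingType) (V : lmodType R) (I K : finType)
    (w : K -> R) (a : K -> I -> R) (v : I -> V) :
  \sum_i (\sum_k w k * a k i) *: v i = \sum_k w k *: (\sum_i a k i *: v i).
Proof.
under eq_bigr do rewrite scaler_suml; under [RHS]eq_bigr do rewrite scaler_sumr.
rewrite exchange_big/=; apply: eq_bigr => k _; apply: eq_bigr => i _.
by rewrite scalerA.
Qed.

(** * Plans, multipliers and their Lagrangian *)

Section plans.
Variables (R : realType) (n : nat) (d : 'I_n -> nat).
Variables (N : forall k : 'I_n, 'cV[R]_(d k) -> R).
Arguments N : clear implicits.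
Hypothesis N_norm : forall k, is_norm (N k).
Variables (r : nat) (C : 'M[R]_(r, \sum_(k < n) d k)) (f : 'cV[R]_r).
Variables (M : nat) (xi : 'I_M -> 'cV[R]_(\sum_(k < n) d k)).
Hypothesis xi_Xi : forall l, polyhedron C f (xi l).
Variable vartheta : 'I_M -> R.
Hypothesis vartheta_ge0 : forall l, 0 <= vartheta l.
Hypothesis vartheta_sum1 : \sum_(l < M) vartheta l = 1.
Variables (eps : 'cV[R]_n).
Hypothesis eps_ge0 : cle 0 eps.
Variables (I J : finType) (i0 : I) (j0 : J).
Variables (alpha : J -> I -> 'cV[R]_(\sum_(k < n) d k)) (b : J -> I -> R).

Let LJ := ('I_M * J)%type.
Let V := 'cV[R]_(\sum_(k < n) d k).

(* x.1 (l, j) is the mass sent from the atom xi l to its j-th destination and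
   x.2 (l, j) is that mass times the displacement xi l - destination: in these
   variables the transport problem is jointly convex. *)
Definition plan := ({ffun LJ -> R^o} * {ffun LJ -> V})%type.

(** The mass is already inside [x.2], so by homogeneity this is the transport cost in block [k] when
    displaced masses are positive. *)
Definition plan_cost (x : plan) k := \sum_e N k (submxcol (x.2 e) k).

(** The last condition concerns atoms of mass zero: the later perturbation cannot give them mass, so
    they must not carry a recession direction. *)
Definition admissible_plan : set plan := [set x : plan |
  [/\ forall e, 0 <= x.1 e,
      forall l, \sum_j x.1 (l, j) = vartheta l,
      forall k, plan_cost x k <= eps k 0 &
      forall e, vartheta e.1 = 0 -> x.2 e = 0]].

(** [y.1] prices the polyhedral constraints at each destination; [y.2] mixes the affine pieces of
    the inner minimum. *)
Definition multiplier := ((LJ -> 'cV[R]_r) * (LJ -> I -> R))%type.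

Definition admissible_multiplier : set multiplier := [set y : multiplier |
  [/\ forall e, cle 0 (y.1 e), forall e i, 0 <= y.2 e i &
      forall e, \sum_i y.2 e i = 1]].

Definition dual_cost (gamma : 'cV[R]_r) (theta : I -> R) l j :=
  \sum_i theta i * (b j i + dot (alpha j i) (xi l)) + dot gamma (f - C *m xi l).

Definition dual_slope (gamma : 'cV[R]_r) (theta : I -> R) j : V :=
  C^T *m gamma - \sum_i theta i *: alpha j i.

(** For positive mass, a summand is the mass times the mixture of affine pieces plus [gamma] against
    the slack, both at the destination. In this form it is linear in the plan and keeps a meaning at
    mass zero. *)
Definition lagrangian (x : plan) (y : multiplier) :=
  \sum_e (x.1 e * dual_cost (y.1 e) (y.2 e) e.1 e.2 +
          dot (dual_slope (y.1 e) (y.2 e) e.2) (x.2 e)).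

Lemma lagrangian_scalar y : scalar (lagrangian^~ y).
Proof.
move=> a x x'; rewrite /lagrangian mulr_sumr -big_split/=.
apply: eq_bigr => e _; rewrite !ffunE dotDr dotZr.
have -> : a *: x.1 e = a * x.1 e by [].
ring.
Qed.

Lemma lagrangian_mix K (w : 'I_K -> R) (y : 'I_K -> multiplier) :
  \sum_i w i = 1 ->
  forall x, lagrangian x (fun e => \sum_i w i *: (y i).1 e,
                          fun e j => \sum_i w i * (y i).2 e j) =
            \sum_i w i * lagrangian x (y i).
Proof.
move=> w1 x; rewrite /lagrangian.
under [RHS]eq_bigr do rewrite mulr_sumr.
rewrite exchange_big/=; apply: eq_bigr => e _.
under [RHS]eq_bigr do rewrite mulrDr mulrCA.
rewrite big_split/= -mulr_sumr; congr (_ * _ + _).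
  rewrite /dual_cost; under [RHS]eq_bigr do rewrite mulrDr.
  rewrite big_split/= dot_suml; congr (_ + _); last first.
    by apply: eq_bigr => i _; rewrite dotZl.
  under eq_bigr do rewrite mulr_suml.
  rewrite exchange_big/=; apply: eq_bigr => i _; rewrite mulr_sumr.
  by apply: eq_bigr => j _; rewrite mulrA.
under [RHS]eq_bigr do rewrite -dotZl.
rewrite -dot_suml; congr dot; rewrite /dual_slope mulmx_sumr.
under [RHS]eq_bigr do rewrite scalerBr scalemxAr.
by rewrite sumrB scaler_exchange.
Qed.

(** Admissibility as sublinear inequalities: each mass equality is split into two, and the factor in
    the last family switches it on at atoms of mass zero only. *)
Let plan_index := (LJ + 'I_M + 'I_M + 'I_n + LJ)%type.

Let plan_fun (i : plan_index) (x : plan) : R :=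
  match i with
  | inl (inl (inl (inl e))) => - x.1 e
  | inl (inl (inl (inr l))) => \sum_j x.1 (l, j)
  | inl (inl (inr l)) => - \sum_j x.1 (l, j)
  | inl (inr k) => plan_cost x k
  | inr e => (vartheta e.1 == 0)%:R * \sum_k N k (submxcol (x.2 e) k)
  end.

Let plan_bound (i : plan_index) : R :=
  match i with
  | inl (inl (inl (inl e))) => 0
  | inl (inl (inl (inr l))) => vartheta l
  | inl (inl (inr l)) => - vartheta l
  | inl (inr k) => eps k 0
  | inr e => 0
  end.

Lemma blocks_eq0 (z : V) : (forall k, N k (submxcol z k) = 0) -> z = 0.
Proof.
move=> Nz; apply/mxcolP => k; rewrite submxcol0.
exact: is_norm_eq0 (N_norm k) _ (Nz k).
Qed.

Let admissible_planE : admissible_plan = [set x : plan | forall i, plan_fun i x <= plan_bound i].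
Proof.
have N0 (z : V) k : 0 <= N k (submxcol z k) by exact: is_norm_ge0.
apply/seteqP; split=> x.
  move=> [x0 xl xk xe] [[[[e|l]|l]|k]|e] /=.
  - by rewrite oppr_le0.
  - by rewrite xl.
  - by rewrite xl.
  - exact: xk.
  case: eqP => [/xe ->|_]; last by rewrite mul0r.
  by rewrite big1 ?mulr0// => k _; rewrite submxcol0 is_norm0.
move=> xP; split=> [e|l|k|e ve].
- by have := xP (inl (inl (inl (inl e)))); rewrite /= oppr_le0.
- apply/eqP; rewrite eq_le; apply/andP; split.
    exact: (xP (inl (inl (inl (inr l))))).
  by have := xP (inl (inl (inr l))); rewrite /= lerN2.
- exact: (xP (inl (inr k))).
apply: blocks_eq0 => k; have := xP (inr e); rewrite /= ve eqxx mul1r => xe.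
apply/eqP; rewrite eq_le N0 andbT; apply: le_trans xe.
by rewrite (bigD1 k)//= lerDl sumr_ge0.
Qed.

Let Nblock_sublinear k e :
  sublinear (fun x : plan => N k (submxcol (x.2 e) k)).
Proof.
split=> [x y|a x a0]; rewrite /= !ffunE.
  by rewrite submxcolD is_normD.
have -> : submxcol (a *: x.2 e) k = a *: submxcol (x.2 e) k.
  by apply/matrixP => i j; rewrite !mxE.
by rewrite is_normZ// ger0_norm.
Qed.

Let plan_fun_sublinear i : sublinear (plan_fun i).
Proof.
have mass (x y : plan) a e : (a *: x.1 + y.1) e = a * x.1 e + y.1 e.
  by rewrite !ffunE.
case: i => [[[[e|l]|l]|k]|e] /=.
- by apply: scalar_sublinear => a x y; rewrite /= mass; ring.
- apply: scalar_sublinear => a x y; rewrite /= mulr_sumr -big_split.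
  by apply: eq_bigr => j _; rewrite mass.
- apply: scalar_sublinear => a x y; rewrite /= mulrN -opprD mulr_sumr -big_split.
  by congr (- _); apply: eq_bigr => j _; rewrite mass.
- exact: sublinear_bigsum.
by apply: sublinear_scale => //; exact: sublinear_bigsum.
Qed.

(** On admissible plans the total mass is 1 and the costs are within budget, which bounds this
    norm. *)
Let plan_norm (x : plan) : R := \sum_e `|x.1 e| + \sum_k plan_cost x k.

Let plan_cost_ge0 x k : 0 <= plan_cost x k.
Proof. by apply: sumr_ge0 => e _; exact: is_norm_ge0. Qed.

Let plan_norm_is_norm : is_norm plan_norm.
Proof.
split=> [x|x|a x|x y].
- by rewrite addr_ge0// sumr_ge0.
- move=> /eqP; rewrite paddr_eq0 ?sumr_ge0// => /andP[/eqP x1 /eqP x2].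
  have {}x1 e : x.1 e = 0.
    by apply/(@normr0_eq0 R R); apply: (psumr_eq0P _ x1) => // e' _; exact: normr_ge0.
  have {}x2 e : x.2 e = 0.
    apply: blocks_eq0 => k.
    have xk : plan_cost x k = 0.
      by apply: (psumr_eq0P _ x2) => // k' _; exact: plan_cost_ge0.
    by apply: (psumr_eq0P _ xk) => // e' _; exact: is_norm_ge0.
  by case: x x1 x2 => u v /= x1 x2; congr pair; apply/ffunP => e; rewrite ffunE.
- rewrite mulrDr !mulr_sumr; congr (_ + _); apply: eq_bigr => e _.
    by rewrite /= ffunE -normrM.
  rewrite mulr_sumr; apply: eq_bigr => e' _; rewrite -is_normZ// /= ffunE.
  by congr N; apply/matrixP => i j; rewrite !mxE.
rewrite addrACA -!big_split; apply: lerD; apply: ler_sum => e _.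
  by rewrite /= ffunE ler_normD.
rewrite -big_split; apply: ler_sum => e' _.
by rewrite /= ffunE submxcolD is_normD.
Qed.

Lemma plan_minimax v :
  (forall y, admissible_multiplier y ->
    exists2 x, admissible_plan x & v <= lagrangian x y) ->
  exists2 x, admissible_plan x &
    forall y, admissible_multiplier y -> v <= lagrangian x y.
Proof.
move=> xy.
pose Y := {y | admissible_multiplier y}.
pose y0 : multiplier := (fun=> 0, fun _ i => (i == i0)%:R).
have y0P : admissible_multiplier y0.
  split=> [e i|e i|e] /=; rewrite ?mxE//.
  by rewrite (bigD1 i0)//= eqxx big1 ?addr0// => i /negPf ->.
have [||x Kx|y|K w y w0 w1||y|x Kx vx] := @sublinear_minimax R plan plan_index Y plan_fun plan_bound
  plan_norm (1 + \sum_k eps k 0) (fun x y => lagrangian x (sval y)) v.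
- exact: plan_fun_sublinear.
- exact: plan_norm_is_norm.
- have [x0 xl xk _] : admissible_plan x by rewrite admissible_planE.
  apply: lerD; last exact: ler_sum.
  under eq_bigr do rewrite ger0_norm//.
  rewrite -vartheta_sum1 (eq_bigr (fun l => \sum_j x.1 (l, j))) ?pair_bigA//=.
  by rewrite le_eqVlt; apply/orP; left; apply/eqP; apply: eq_bigr => -[].
- exact: lagrangian_scalar.
- pose z : multiplier := (fun e => \sum_i w i *: (sval (y i)).1 e,
                          fun e j => \sum_i w i * (sval (y i)).2 e j).
  have zP : admissible_multiplier z.
    split=> [e a|e i|e] /=.
    - rewrite !mxE summxE; apply: sumr_ge0 => i _; rewrite mxE mulr_ge0//.
      by case: (svalP (y i)) => + _ _ => /(_ e a); rewrite mxE.
    - by apply: sumr_ge0 => i' _; rewrite mulr_ge0//; case: (svalP (y i')).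
    rewrite exchange_big/= -w1; apply: eq_bigr => i _; rewrite -mulr_sumr.
    by case: (svalP (y i)) => _ _ ->; rewrite mulr1.
  by exists (exist _ z zP) => x; exact: lagrangian_mix.
- exact: (exist _ y0 y0P).
- have [x Kx vx] := xy _ (svalP y); exists x => //.
  by move: Kx; rewrite admissible_planE.
exists x => [|y yP]; first by rewrite admissible_planE.
exact: (vx (exist _ y yP)).
Qed.

Definition plan_value (x : plan) (i : LJ -> I) :=
  \sum_e (x.1 e * (b e.2 (i e) + dot (alpha e.2 (i e)) (xi e.1))
          - dot (alpha e.2 (i e)) (x.2 e)).

(** When each simplex weight selects one piece, the Lagrangian separates into the value of that
    selection and [gamma] against the mass-weighted slacks at the destinations. *)
Lemma lagrangian_vertex x (i : LJ -> I) (gamma : LJ -> 'cV[R]_r) :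
  lagrangian x (gamma, fun e i' => (i' == i e)%:R) =
  plan_value x i +
  \sum_e dot (gamma e) (x.1 e *: (f - C *m xi e.1) + C *m x.2 e).
Proof.
rewrite -big_split; apply: eq_bigr => e _ /=.
have vertex (W : lmodType R) (F : I -> W) :
    \sum_i' (i' == i e)%:R *: F i' = F (i e).
  rewrite (bigD1 (i e))//= eqxx scale1r big1 ?addr0// => i' /negPf ->.
  by rewrite scale0r.
have vertexR (F : I -> R) : \sum_i' (i' == i e)%:R * F i' = F (i e).
  exact: vertex R^o F.
rewrite /dual_cost /dual_slope/= vertexR vertex.
rewrite dotBl dot_trmxl [in RHS](dotDr _ (_ *: _)) dotZr; ring.
Qed.

(** Testing at vertices with [gamma = 0] bounds the value of every selection; a negative slack would
    let a large [gamma] drive the Lagrangian below [v]. *)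
Lemma saddle_feasible x v :
  (forall y, admissible_multiplier y -> v <= lagrangian x y) ->
  (forall e, cle 0 (x.1 e *: (f - C *m xi e.1) + C *m x.2 e)) /\
  (forall i, v <= plan_value x i).
Proof.
move=> vx.
have vertexP (i : LJ -> I) gamma : (forall e, cle 0 (gamma e)) ->
    admissible_multiplier (gamma, fun e i' => (i' == i e)%:R).
  move=> g0; split=> [//|e i' /=|e /=]; first exact: ler0n.
  by rewrite (bigD1 (i e))//= eqxx big1 ?addr0// => i' /negPf ->.
split=> [e a|i]; last first.
  have zero_ge0 (e : LJ) : cle 0 (0 : 'cV[R]_r) by [].
  have := vx _ (vertexP i (fun=> 0) zero_ge0); rewrite lagrangian_vertex.
  by rewrite big1 ?addr0// => e _; rewrite dotC dot0r.
rewrite [leLHS]mxE leNgt; apply/negP; set g := fun_of_matrix _ a 0 => g0.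
(* Chosen so that the slack term exceeds in size the gap between [v] and the value by 1. *)
pose t := (`|v - plan_value x (fun=> i0)| + 1) / - g.
have t0 : 0 <= t by rewrite divr_ge0 ?addr_ge0// oppr_ge0 ltW.
pose gamma e' : 'cV[R]_r := if e' == e then t *: delta_mx a 0 else 0.
have gamma0 e' : cle 0 (gamma e').
  by move=> a'; rewrite /gamma; case: eqP => _; rewrite !mxE// mulr_ge0.
have := vx _ (vertexP (fun=> i0) gamma gamma0); rewrite lagrangian_vertex.
have delta_dot (u : 'cV[R]_r) : dot (delta_mx a 0) u = u a 0.
  rewrite /dot (bigD1 a)//= mxE !eqxx mul1r big1 ?addr0// => a' /negPf a'a.
  by rewrite mxE a'a mul0r.
have -> : \sum_e' dot (gamma e') (x.1 e' *: (f - C *m xi e'.1) + C *m x.2 e') = t * g.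
  rewrite (bigD1 e)//= [X in _ + X = _]big1 => [|e' e'e]; last first.
    by rewrite /gamma (negPf e'e) dotC dot0r.
  by rewrite /gamma eqxx dotZl delta_dot addr0.
have -> : t * g = - (`|v - plan_value x (fun=> i0)| + 1).
  by rewrite /t -mulrA invrN mulNr mulVf ?mulrN1// lt_eqF.
have := ler_norm (plan_value x (fun=> i0) - v); rewrite distrC; lra.
Qed.

(** A near-best response to [y]: each atom sends its mass to the destination of largest cost, and
    the whole budget of block [k] is spent where the dual norm of the slope is largest, in a nearly
    optimal direction. The maxima serve as [s] and [lambda]. Displacement may land where there is no
    mass. *)
Lemma lagrangian_dual (y : multiplier) delta :
  0 < delta -> exists x (rho : 'I_M -> 'I_M) (lambda : 'I_n -> R) (s : 'I_M -> R),
    [/\ admissible_plan x,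
      forall l j, dual_cost (y.1 (rho l, j)) (y.2 (rho l, j)) l j <= s l,
      forall l j k, dual_norm (N k)
        (submxcol (dual_slope (y.1 (rho l, j)) (y.2 (rho l, j)) j) k) <= lambda k &
      \sum_k lambda k * eps k 0 + \sum_l vartheta l * s l - delta <= lagrangian x y].
Proof.
move=> delta0.
have [l0 vl0] : exists l0, vartheta l0 != 0.
  apply: contrapT => nov; have := vartheta_sum1; rewrite big1 => [|l _].
    by move/eqP; rewrite eq_sym oner_eq0.
  by apply: contrapT => vl; apply: nov; exists l; exact/eqP.
(* Atoms of mass zero borrow the multipliers of l0, so that the maximum
   defining lambda is attained at an atom from which mass can be moved. *)
pose rho l := if vartheta l == 0 then l0 else l.
have rho_neq0 l : vartheta (rho l) != 0 by rewrite /rho; case: ifPn.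
pose cost l j := dual_cost (y.1 (rho l, j)) (y.2 (rho l, j)) l j.
pose slope l j := dual_slope (y.1 (rho l, j)) (y.2 (rho l, j)) j.
have /choice[jmax jmaxP] l : exists jm : J, forall j, cost l j <= cost l jm.
  case: (@Order.TotalTheory.arg_maxP _ _ _ j0 predT (cost l) isT) => jm _ jmP.
  by exists jm => j; exact: jmP.
pose dn k (e : LJ) := dual_norm (N k) (submxcol (slope e.1 e.2) k).
have /choice[emax emaxP] k : exists em : LJ, forall e, dn k e <= dn k em.
  case: (@Order.TotalTheory.arg_maxP _ _ _ (l0, j0) predT (dn k) isT) => em _ emP.
  by exists em => e; exact: emP.
pose em k : LJ := (rho (emax k).1, (emax k).2).
have slope_em k : dual_slope (y.1 (em k)) (y.2 (em k)) (em k).2 =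
    slope (emax k).1 (emax k).2 by [].
pose E := \sum_k eps k 0.
have E0 : 0 <= E by apply: sumr_ge0 => k _; have := eps_ge0 k; rewrite mxE.
(* With this tolerance per unit of budget the total loss is at most [delta]; the added 1 covers
   [E = 0]. *)
have dE : 0 < delta / (E + 1) by rewrite divr_gt0// ltr_wpDl.
pose u k := s2val (cid2 (dual_norm_approx (N_norm k)
  (submxcol (slope (emax k).1 (emax k).2) k) dE)).
have u1 k : N k (u k) <= 1 by rewrite /u; case: cid2.
have uz k : dn k (emax k) - delta / (E + 1) <
    dot (submxcol (slope (emax k).1 (emax k).2) k) (u k).
  by rewrite /u; case: cid2.
pose q e : V := \mxcol_k (((e == em k)%:R * eps k 0) *: u k).
exists ([ffun e => vartheta e.1 * (e.2 == jmax e.1)%:R], [ffun e => q e]).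
exists rho, (fun k => dn k (emax k)), (fun l => cost l (jmax l)).
split=> [|//|l j k|].
- split=> [e|l|k|e ve] /=.
  + by rewrite ffunE mulr_ge0.
  + under eq_bigr do rewrite ffunE/=.
    by rewrite -mulr_sumr (bigD1 (jmax l))//= eqxx big1 ?addr0 ?mulr1// => j /negPf ->.
  + rewrite /plan_cost (bigD1 (em k))//= big1 => [|e /negPf eem]; last first.
      by rewrite ffunE mxcolK eem mul0r scale0r is_norm0.
    have ek := eps_ge0 k; rewrite mxE in ek.
    by rewrite ffunE mxcolK eqxx mul1r addr0 is_normZ// ger0_norm// ler_piMr.
  rewrite ffunE; apply: blocks_eq0 => k; rewrite mxcolK.
  case: eqP => [eE|_]; last by rewrite mul0r scale0r is_norm0.
  by have := rho_neq0 (emax k).1; rewrite -[rho _]/(em k).1 -eE ve eqxx.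
- exact: emaxP k (l, j).
rewrite /lagrangian big_split/= addrAC [leLHS]addrC; apply: lerD.
  rewrite le_eqVlt; apply/orP; left; apply/eqP.
  transitivity (\sum_l \sum_j (vartheta l * (j == jmax l)%:R) *
      dual_cost (y.1 (l, j)) (y.2 (l, j)) l j); last first.
    by rewrite pair_bigA; apply: eq_bigr => -[l j] _; rewrite /= ffunE.
  apply: eq_bigr => l _; rewrite (bigD1 (jmax l))//= [X in _ = _ + X]big1; last first.
    by move=> j /negPf ->; rewrite mulr0 mul0r.
  rewrite eqxx mulr1 addr0 /cost /rho.
  (* Where the multipliers are borrowed, the atom has mass zero and both sides vanish. *)
  by case: eqP => // ->; rewrite !mul0r.
under [leRHS]eq_bigr do rewrite ffunE dot_submxcol.
rewrite exchange_big/=.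
apply: (@le_trans _ _ (\sum_k (dn k (emax k) * eps k 0 - eps k 0 * (delta / (E + 1))))).
  rewrite sumrB lerD2l lerN2 -mulr_suml -/E mulrCA ler_piMr ?(ltW delta0)//.
  by rewrite ler_pdivrMr ?ltr_wpDl// mul1r lerDl.
apply: ler_sum => k _; rewrite (bigD1 (em k))//= big1 => [|e /negPf eem]; last first.
  by rewrite mxcolK eem mul0r scale0r dot0r.
rewrite mxcolK eqxx mul1r addr0 dotZr slope_em mulrC -mulrBr.
have ek := eps_ge0 k; rewrite mxE in ek.
by apply: ler_wpM2l => //; exact/ltW/uz.
Qed.

(** * From plans to couplings, and the two inequalities *)

Variables (h : V -> R) (Q : probability (borelV R (\sum_(k < n) d k)) R).
Hypothesis mh : measurable_fun setT (h : borelV R (\sum_(k < n) d k) -> R).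
Hypothesis QE : forall A : set (borelV R (\sum_(k < n) d k)), measurable A ->
  Q A = (\sum_(l < M) (vartheta l)%:E *
         \d_(xi l : borelV R (\sum_(k < n) d k)%N) A)%E.

Lemma expectation_integral (P : probability (borelV R (\sum_(k < n) d k)) R) :
  ('E_P[h] = \int[P]_x (h x)%:E)%E.
Proof. by rewrite unlock. Qed.

(** Since the inverse of 0 is 0, an index of mass zero has its own atom as destination. *)
Definition destination (x : plan) (e : LJ) : V :=
  xi e.1 - (x.1 e)^-1 *: x.2 e.

(** The coupling puts mass [x.1 e] on the pair of the atom and [destination x e]. Dividing the slack
    condition by the mass places destinations in the polyhedron, and the second hypothesis excludes
    recession directions. *)
Lemma plan_transport x : admissible_plan x ->
  (forall e, x.1 e = 0 -> x.2 e = 0) ->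
  (forall e, cle 0 (x.1 e *: (f - C *m xi e.1) + C *m x.2 e)) ->
  exists2 P, multi_transport N (polyhedron C f) Q eps P &
    ('E_P[h] = (\sum_e x.1 e * h (destination x e))%:E)%E.
Proof.
move=> [x0 xl xk _] x10 xC.
have destXi e : polyhedron C f (destination x e).
  have [e0|e0] := eqVneq (x.1 e) 0.
    by rewrite /destination x10// scaler0 subr0.
  have ep : 0 < x.1 e by rewrite lt_neqAle eq_sym e0 x0.
  move=> a; have := xC e a.
  rewrite /destination mulmxBr -scalemxAr !mxE => xCa.
  rewrite -(ler_pM2l ep) mulrBr mulrA divff// mul1r; lra.
have mass1 : \sum_e x.1 e = 1.
  rewrite -vartheta_sum1 -(eq_bigr _ (fun l _ => xl l)) pair_bigA.
  by apply: eq_bigr => -[].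
pose W := borelV R (\sum_(k < n) d k).
have [P PE] := @discrete_probability_exists _ W R LJ x.1 (destination x) x0
  (index_enum LJ) mass1.
have [pi piE] := @discrete_probability_exists _ (W * W)%type R LJ x.1
  (fun e => (xi e.1 : W, destination x e : W)) x0 (index_enum LJ) mass1.
exists P; last first.
  by rewrite expectation_integral (integral_discrete x0 (fun A _ => PE A) mh).
exists pi; split => [|A mA|A mA|k].
- rewrite piE -mass1 -sumEFin; apply: eq_bigr => e _.
  by rewrite diracE mem_set ?mule1//; split; [exact: xi_Xi|exact: destXi].
- rewrite /pushforward piE QE//.
  transitivity (\sum_l \sum_j (x.1 (l, j))%:E * \d_(xi l : W) A)%E.
    by rewrite pair_bigA; apply: eq_bigr => -[l j] _; rewrite !diracE.
  apply: eq_bigr => l _; rewrite -xl -sumEFin ge0_sume_distrl// => j _.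
  by rewrite lee_fin.
- by rewrite /pushforward piE PE; apply: eq_bigr => e _; rewrite !diracE.
have N0 (w : W * W) : (0 <= (N k (submxcol ((w.1 : V) - w.2) k))%:E)%E.
  by rewrite lee_fin; exact: is_norm_ge0.
apply: (le_trans (ge0_integral_discrete_le x0 (fun A _ => piE A) N0)).
under eq_bigr do rewrite -EFinM.
rewrite sumEFin lee_fin; apply: le_trans (xk k); apply: ler_sum => e _ /=.
rewrite /destination opprB addrC subrK.
have -> : submxcol ((x.1 e)^-1 *: x.2 e) k = (x.1 e)^-1 *: submxcol (x.2 e) k.
  by apply/matrixP => i j; rewrite !mxE.
have [e0|e0] := eqVneq (x.1 e) 0; first by rewrite e0 mul0r is_norm_ge0.
by rewrite is_normZ// ger0_norm ?invr_ge0// mulrA divff// mul1r.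
Qed.

Definition dual_values : set (\bar R) :=
  [set v | exists (lambda : 'cV[R]_n) (s : 'I_M -> R)
      (gamma : 'I_M -> J -> 'cV[R]_r) (theta : 'I_M -> J -> I -> R),
    [/\ forall l j, dual_cost (gamma l j) (theta l j) l j <= s l,
        forall l j k, dual_norm (N k)
          (submxcol (dual_slope (gamma l j) (theta l j) j) k) <= lambda k 0,
        forall l j, cle 0 (gamma l j),
        forall l j, (forall i, 0 <= theta l j i) /\ \sum_i theta l j i = 1 &
        v = (dot lambda eps + \sum_(l < M) vartheta l * s l)%:E]].

Lemma block_norm_continuous (z : V) k :
  continuous (fun y : V => N k (submxcol (z - y) k)).
Proof.
have csub : continuous (fun y : V => z - y).
  by move=> y; exact: (@cvgB _ _ _ _ (nbhs_filter y) _ _ _ _ (cvg_cst _) (@cvg_id _ (nbhs y))).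
have cN : continuous (fun y : V => N k (submxcol y k)).
  apply: sublinear_continuous; split=> [u u'|a u a0].
    by rewrite submxcolD is_normD.
  have -> : submxcol (a *: u) k = a *: submxcol u k.
    by apply/matrixP => i j; rewrite !mxE.
  by rewrite is_normZ// ger0_norm.
by move=> y; exact: (continuous_comp (csub y) (cN _)).
Qed.

(** At each point [h] lies below every piece of some family [j], hence below any mixture of that
    family; the resulting pointwise bound is integrated along the coupling. *)
Lemma weak_duality P v :
  (forall x, exists j, forall i, h x <= dot (alpha j i) x + b j i) ->
  multi_transport N (polyhedron C f) Q eps P -> dual_values v ->
  ('E_P[h] <= v)%E.
Proof.
move=> h_le [pi [piXi pi1 pi2 pieps]] [lambda [s [gamma [theta]]]].
move=> [hs hlambda g0 t0 ->].
have [l0 _] : exists l0 : 'I_M, True.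
  apply: contrapT => noM; have := vartheta_sum1.
  rewrite big1 => [/eqP|l _]; first by rewrite eq_sym oner_eq0.
  by case: noM; exists l.
pose W := borelV R (\sum_(k < n) d k).
rewrite expectation_integral.
apply: (@transport_integral_le _ W R M n l0 xi vartheta vartheta_ge0 Q P pi
  (polyhedron C f) QE _ _ piXi pi1 pi2
  (fun k x y => N k (submxcol ((x : V) - y) k)) (fun k => eps k 0) _ _ pieps h
  (fun k => lambda k 0) s mh).
- by move=> l; exact: borelV_set1.
- by apply: borelV_closed; exact: polyhedron_closed.
- by move=> k x y; exact: is_norm_ge0.
- by move=> k l; apply: continuous_measurable_borelV; exact: block_norm_continuous.
(* Nonnegativity of [lambda] comes from its dominating a dual norm. *)
- by move=> k; apply: le_trans (hlambda l0 j0 k); exact: dual_norm_ge0.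
move=> l y fy; have [j hj] := h_le y; have [tl0 tl1] := t0 l j.
apply: le_trans (affine_le_dual N_norm fy (g0 l j) (hs l j) (hlambda l j)).
rewrite -[h y]mul1r -tl1 mulr_suml; apply: ler_sum => i _.
exact: ler_wpM2l.
Qed.

(* Mixing with the plan that splits the mass of each atom evenly and moves
   nothing makes every mass positive, so that the mass-weighted displacements
   come from actual destinations; the loss is linear in t. *)
Lemma plan_perturbation x v t : admissible_plan x -> 0 < t <= 1 ->
  (forall e, cle 0 (x.1 e *: (f - C *m xi e.1) + C *m x.2 e)) ->
  (forall i, v <= plan_value x i) ->
  (forall x j, exists i, dot (alpha j i) x + b j i <= h x) ->
  exists2 P, multi_transport N (polyhedron C f) Q eps P &
    (((1 - t) * v - t * \sum_(e : LJ) vartheta e.1 *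
       \sum_i `|b e.2 i + dot (alpha e.2 i) (xi e.1)|)%:E <= 'E_P[h])%E.
Proof.
move=> [x0 xl xk xe] /andP[t0 t1] xC xv h_ge.
have t1' : 0 <= 1 - t by rewrite subr_ge0.
have J0 : 0 < #|J|%:R :> R by rewrite ltr0n; apply/card_gt0P; exists j0.
pose u (e : LJ) : R := vartheta e.1 / #|J|%:R.
have u0 e : 0 <= u e by rewrite divr_ge0// ltW.
pose z : plan := ([ffun e => (1 - t) * x.1 e + t * u e], [ffun e => (1 - t) *: x.2 e]).
have z1 e : z.1 e = (1 - t) * x.1 e + t * u e by rewrite ffunE.
have z2 e : z.2 e = (1 - t) *: x.2 e by rewrite ffunE.
have z10 e : 0 <= z.1 e by rewrite z1 addr_ge0// mulr_ge0// ltW.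
(* A mass can vanish only over an atom of mass zero, where admissibility forbids displacement. *)
have z_eq0 e : z.1 e = 0 -> z.2 e = 0.
  rewrite z1 z2 => /eqP; rewrite paddr_eq0 ?mulr_ge0// ?(ltW t0)//.
  move=> /andP[_]; rewrite mulf_eq0 (gt_eqF t0)/= mulf_eq0 invr_eq0 (gt_eqF J0) orbF.
  by move=> /eqP/xe ->; rewrite scaler0.
have admz : admissible_plan z.
  split=> // [l|k|e ve]; last by rewrite z2 xe// scaler0.
    under eq_bigr do rewrite z1.
    have -> : \sum_j ((1 - t) * x.1 (l, j) + t * u (l, j)) =
        (1 - t) * \sum_j x.1 (l, j) + t * \sum_j u (l, j).
      by rewrite big_split/= -!mulr_sumr.
    have -> : \sum_j u (l, j) = vartheta l.
      by rewrite /u/= sumr_const -[LHS]mulr_natr divfK// gt_eqF.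
    by rewrite xl; ring.
  apply: le_trans (xk k); apply: ler_sum => e _; rewrite z2.
  have -> : submxcol ((1 - t) *: x.2 e) k = (1 - t) *: submxcol (x.2 e) k.
    by apply/matrixP => i j; rewrite !mxE.
  by rewrite is_normZ// ger0_norm// ler_piMl ?is_norm_ge0// gerBl ltW.
have zC e : cle 0 (z.1 e *: (f - C *m xi e.1) + C *m z.2 e).
  move=> a; have := xC e a; have := xi_Xi e.1 a.
  rewrite z1 z2 -scalemxAr !mxE => fa xa.
  have : 0 <= (1 - t) * (x.1 e * (f a 0 - (C *m xi e.1) a 0) + (C *m x.2 e) a 0).
    by rewrite mulr_ge0// !mxE.
  have : 0 <= (t * u e) * (f a 0 - (C *m xi e.1) a 0).
    by rewrite mulr_ge0 ?mulr_ge0 ?(ltW t0)// subr_ge0 !mxE.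
  rewrite !mxE; lra.
have [P TP PE] := plan_transport admz z_eq0 zC.
exists P => //; rewrite PE lee_fin.
(* Selecting at each destination a piece below [h] bounds the expectation from below by a plan
   value, which is affine in [t]. *)
have /choice[i iP] e : exists i, dot (alpha e.2 i) (destination z e) + b e.2 i
    <= h (destination z e) by exact: h_ge.
apply: (@le_trans _ _ (plan_value z i)); last first.
  apply: ler_sum => e _; apply: le_trans (ler_wpM2l (z10 e) (iP e)).
  rewrite /destination dotBr dotZr.
  have [e0|e0] := eqVneq (z.1 e) 0; first by rewrite (z_eq0 _ e0) e0 dot0r !mul0r subr0.
  rewrite le_eqVlt; apply/orP; left; apply/eqP.
  by field.
have -> : plan_value z i = (1 - t) * plan_value x i +
    t * \sum_e u e * (b e.2 (i e) + dot (alpha e.2 (i e)) (xi e.1)).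
  rewrite /plan_value !mulr_sumr -big_split/=; apply: eq_bigr => e _.
  by rewrite z1 z2 dotZr; ring.
apply: lerD; first exact: ler_wpM2l.
rewrite -mulrN ler_pM2l// -sumrN; apply: ler_sum => e _.
rewrite lerNl -mulrN.
have uv : u e <= vartheta e.1.
  by rewrite ler_pdivrMr// ler_peMr// ler1n; apply/card_gt0P; exists j0.
apply: (@le_trans _ _ (u e * `|b e.2 (i e) + dot (alpha e.2 (i e)) (xi e.1)|)).
  by apply: ler_wpM2l => //; rewrite -normrN ler_norm.
apply: ler_pM => //; rewrite (bigD1 (i e))//= lerDl; exact: sumr_ge0.
Qed.

(** Against each multiplier some plan reaches [v] up to [e / 2]; minimax yields one plan good
    against all of them, and the perturbation costs the other [e / 2]. *)
Lemma strong_duality v :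
  (forall x j, exists i, dot (alpha j i) x + b j i <= h x) ->
  (v%:E <= ereal_inf dual_values)%E ->
  (v%:E <= ereal_sup [set ('E_P[h])%E |
     P in multi_transport N (polyhedron C f) Q eps])%E.
Proof.
move=> h_ge vinf; apply/lee_addgt0Pr => e e0.
have e20 : 0 < e / 2 by rewrite divr_gt0.
have [y [g0 th0 th1]|x admx xv] := @plan_minimax (v - e / 2).
  have [x [rho [lambda [s [admx hs hl xy]]]]] := lagrangian_dual y e20.
  exists x => //; apply: le_trans xy; rewrite lerD2r -lee_fin.
  apply: (le_trans vinf); apply: ereal_inf_lbound.
  exists (\col_k lambda k), s, (fun l j => y.1 (rho l, j)), (fun l j => y.2 (rho l, j)).
  split=> //; first by move=> l j k; rewrite mxE; exact: hl.
  by congr (_ + _)%:E; apply: eq_bigr => k _; rewrite mxE.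
have [xC xval] := saddle_feasible xv.
pose B := \sum_(e : LJ) vartheta e.1 *
  \sum_i `|b e.2 i + dot (alpha e.2 i) (xi e.1)|.
have B0 : 0 <= B.
  by apply: sumr_ge0 => e' _; rewrite mulr_ge0// sumr_ge0.
(* The last two terms bound the loss per unit of [t]; the first makes [S] positive and [t] at most
   1. *)
pose S := e / 2 + `|v - e / 2| + B.
have S0 : 0 < S by rewrite /S; have := normr_ge0 (v - e / 2); lra.
pose t := e / 2 / S.
have tS : t * S = e / 2 by rewrite /t divfK// gt_eqF.
have t01 : 0 < t <= 1.
  rewrite divr_gt0//= ler_pdivrMr// mul1r /S.
  by have := normr_ge0 (v - e / 2); lra.
have [P TP PE] := plan_perturbation admx t01 xC xval h_ge.
apply: (@le_trans _ _ ('E_P[h] + e%:E)%E); last first.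
  by apply: leeD2r; apply: ereal_sup_ubound; exists P.
apply: le_trans (leeD2r _ PE); rewrite -EFinD lee_fin -/B.
have /andP[t0 _] := t01.
have : t * (v - e / 2) <= t * `|v - e / 2| by rewrite ler_pM2l// ler_norm.
by move: tS; rewrite /S; nra.
Qed.

(** Together the two hypotheses say that [h] is the maximum over [j] of the minima over [i] of the
    affine pieces. *)
Lemma transport_duality :
  (forall x, exists j, forall i, h x <= dot (alpha j i) x + b j i) ->
  (forall x j, exists i, dot (alpha j i) x + b j i <= h x) ->
  ereal_sup [set ('E_P[h])%E | P in multi_transport N (polyhedron C f) Q eps] =
  ereal_inf dual_values.
Proof.
move=> h_le h_ge; apply/eqP; rewrite eq_le; apply/andP; split.
  apply: ge_ereal_sup => _ [P TP <-]; apply: le_ereal_inf_tmp => v dv.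
  exact: weak_duality.
(* If the dual is infeasible its infimum is plus infinity, and strong duality at every real [v]
   makes the supremum infinite too. *)
case E : (ereal_inf dual_values) => [v| |]; last by rewrite leNye.
  by apply: strong_duality => //; rewrite E.
rewrite leye_eq; apply/eqP/eq_infty => v.
by apply: strong_duality => //; rewrite E leey.
Qed.

End plans.

(** * Specialisation to maxima and minima of affine functions *)

Lemma max_affine_continuous (R : realType) D m (alpha : 'I_m.+1 -> 'cV[R]_D) b :
  continuous (max_affine alpha b).
Proof.
rewrite /max_affine; elim: (index_enum _) => [|j s IH] x.
  under eq_fun do rewrite big_nil; exact: affine_continuous.
under eq_fun do rewrite big_cons.
by apply: (@continuous_max _ _ (affine alpha b j)); [exact: affine_continuous|exact: IH].
Qed.

Lemma min_affine_continuous (R : realType) D m (alpha : 'I_m.+1 -> 'cV[R]_D) b :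
  continuous (min_affine alpha b).
Proof.
rewrite /min_affine; elim: (index_enum _) => [|j s IH] x.
  under eq_fun do rewrite big_nil; exact: affine_continuous.
under eq_fun do rewrite big_cons.
by apply: (@continuous_min _ _ (affine alpha b j)); [exact: affine_continuous|exact: IH].
Qed.

Lemma max_affine_attained (R : realType) D m (alpha : 'I_m.+1 -> 'cV[R]_D) b x :
  exists j, max_affine alpha b x <= affine alpha b j x.
Proof.
case: (@Order.TotalTheory.arg_maxP _ _ _ ord0 predT
  (fun j => affine alpha b j x) isT) => j _ jP.
by exists j; apply: bigmax_le => [|i _]; exact: jP.
Qed.

Lemma min_affine_attained (R : realType) D m (alpha : 'I_m.+1 -> 'cV[R]_D) b x :
  exists j, affine alpha b j x <= min_affine alpha b x.
Proof.
case: (@Order.TotalTheory.arg_minP _ _ _ ord0 predT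
  (fun j => affine alpha b j x) isT) => j _ jP.
by exists j; apply: le_bigmin => [|i _]; exact: jP.
Qed.

Lemma row_matrix_mul (R : realType) D m (alpha : 'I_m -> 'cV[R]_D) x i :
  (row_matrix alpha *m x) i 0 = dot (alpha i) x.
Proof. by rewrite mxE; apply: eq_bigr => a _; rewrite mxE. Qed.

Lemma row_matrix_trmul (R : realType) D m (alpha : 'I_m -> 'cV[R]_D) theta :
  (row_matrix alpha)^T *m theta = \sum_i theta i 0 *: alpha i.
Proof.
apply/colP => a; rewrite mxE summxE; apply: eq_bigr => i _.
by rewrite !mxE mulrC.
Qed.

Theorem proposition5p2 (R : realType)
    (n : nat) (d : 'I_n -> nat)
    (N : forall k : 'I_n, 'cV[R]_(d k) -> R)
    (N_norm : forall k : 'I_n, is_norm (N k))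
    (r : nat) (C : 'M[R]_(r, \sum_(k < n) d k)) (f : 'cV[R]_r)
    (M : nat) (xi : 'I_M -> 'cV[R]_(\sum_(k < n) d k))
    (xi_Xi : forall l : 'I_M, polyhedron C f (xi l))
    (vartheta : 'I_M -> R)
    (vartheta_ge0 : forall l : 'I_M, 0 <= vartheta l)
    (vartheta_sum1 : \sum_(l < M) vartheta l = 1)
    (Q : probability (borelV R (\sum_(k < n) d k)) R)
    (Q_discrete : forall A : set (borelV R (\sum_(k < n) d k)), measurable A ->
       Q A = (\sum_(l < M) (vartheta l)%:E * \d_(xi l : borelV R (\sum_(k < n) d k)%N) A)%E)
    (eps : 'cV[R]_n) (eps_ge0 : cle 0 eps)
    (m : nat) (alpha : 'I_m.+1 -> 'cV[R]_(\sum_(k < n) d k))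
    (b : 'cV[R]_m.+1) :
  ereal_sup [set ('E_P[max_affine alpha b])%E |
      P in multi_transport N (polyhedron C f) Q eps]
  = ereal_inf [set v | exists (lambda : 'cV[R]_n) (s : 'I_M -> R)
      (gamma : 'I_M -> 'I_m.+1 -> 'cV[R]_r),
      [/\ forall l j,
            b j 0 + dot (alpha j) (xi l) + dot (gamma l j) (f - C *m xi l)
            <= s l,
          forall l j k,
            dual_norm (N k) (submxcol (C^T *m gamma l j - alpha j) k)
            <= lambda k 0,
          forall l j, cle 0 (gamma l j) &
          v = (dot lambda eps + \sum_(l < M) vartheta l * s l)%:E]]
  /\
  ereal_sup [set ('E_P[min_affine alpha b])%E |
      P in multi_transport N (polyhedron C f) Q eps]
  = ereal_inf [set v | exists (lambda : 'cV[R]_n) (s : 'I_M -> R)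
      (gamma : 'I_M -> 'cV[R]_r) (theta : 'I_M -> 'cV[R]_m.+1),
      [/\ forall l,
            dot (theta l) (b + row_matrix alpha *m xi l)
              + dot (gamma l) (f - C *m xi l) <= s l,
          forall l k,
            dual_norm (N k)
              (submxcol (C^T *m gamma l - (row_matrix alpha)^T *m theta l) k)
            <= lambda k 0,
          forall l, dot (theta l) (const_mx 1) = 1,
          forall l, cle 0 (gamma l) /\ cle 0 (theta l) &
          v = (dot lambda eps + \sum_(l < M) vartheta l * s l)%:E]].
Proof.
have mcont (g : 'cV[R]_(\sum_(k < n) d k) -> R) : continuous g ->
    measurable_fun setT (g : borelV R (\sum_(k < n) d k) -> R).
  exact: continuous_measurable_borelV.
split.
  (* For the maximum [i] ranges over a singleton, so the simplex weight is forced to be 1 and drops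
     out. *)
  rewrite (transport_duality N_norm xi_Xi vartheta_ge0 vartheta_sum1 eps_ge0
    (ord0 : 'I_1) (ord0 : 'I_m.+1) (alpha := fun j _ => alpha j)
    (b := fun j _ => b j 0) (mcont _ (@max_affine_continuous R _ m alpha b))
    Q_discrete); last 2 first.
  - by move=> x; have [j hj] := max_affine_attained alpha b x; exists j.
  - by move=> x j; exists ord0; exact: le_bigmax.
  congr ereal_inf; apply/seteqP; split=> v.
    move=> [lambda [s [gamma [theta [hs hl g0 t01 ->]]]]].
    exists lambda, s, gamma; split=> // [l j|l j k].
      have [_ t1] := t01 l j; rewrite big_ord1 in t1.
      by have := hs l j; rewrite /dual_cost big_ord1 t1 mul1r.
    have [_ t1] := t01 l j; rewrite big_ord1 in t1.
    by have := hl l j k; rewrite /dual_slope big_ord1 t1 scale1r.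
  move=> [lambda [s [gamma [hs hl g0 ->]]]].
  exists lambda, s, gamma, (fun _ _ _ => 1); split=> // [l j|l j k|l j].
  - by rewrite /dual_cost big_ord1 mul1r.
  - by rewrite /dual_slope big_ord1 scale1r.
  by rewrite big_ord1.
(* For the minimum [j] ranges over a singleton, so one [gamma] and one weight vector remain per
   atom; the sums over [i] become products with the matrix of rows. *)
rewrite (transport_duality N_norm xi_Xi vartheta_ge0 vartheta_sum1 eps_ge0
  (ord0 : 'I_m.+1) (ord0 : 'I_1) (alpha := fun _ i => alpha i)
  (b := fun _ i => b i 0) (mcont _ (@min_affine_continuous R _ m alpha b))
  Q_discrete); last 2 first.
- by move=> x; exists ord0 => i; exact: bigmin_le.
- by move=> x j; exact: min_affine_attained.
have costE l gamma (theta : 'cV[R]_m.+1) : dual_cost C f xi (fun (_ : 'I_1) i => alpha i)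
    (fun _ i => b i 0) gamma (fun i => theta i 0) l ord0 =
  dot theta (b + row_matrix alpha *m xi l) + dot gamma (f - C *m xi l).
  congr (_ + _); apply: eq_bigr => i _.
  by rewrite [(b + _) i 0]mxE row_matrix_mul.
congr ereal_inf; apply/seteqP; split=> v.
  move=> [lambda [s [gamma [theta [hs hl g0 t01 ->]]]]].
  pose th l : 'cV[R]_m.+1 := \col_i theta l ord0 i.
  have thE l : (fun i => th l i 0) = theta l ord0.
    by apply/funext => i; rewrite mxE.
  exists lambda, s, (fun l => gamma l ord0), th; split=> // [l|l k|l|l].
  - by rewrite -costE thE.
  - have := hl l ord0 k; rewrite /dual_slope -thE row_matrix_trmul; exact.
  - have [_ t1] := t01 l ord0; rewrite -[RHS]t1; apply: eq_bigr => i _.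
    by rewrite !mxE mulr1.
  split=> // i; rewrite !mxE; by have [] := t01 l ord0.
move=> [lambda [s [gamma [theta [hs hl t1 g0 ->]]]]].
exists lambda, s, (fun l _ => gamma l), (fun l _ i => theta l i 0).
split=> // [l j|l j k|l j|l j].
- by rewrite ord1 costE.
- by rewrite /dual_slope -row_matrix_trmul.
- by have [] := g0 l.
split=> [i|]; first by have [_ /(_ i)] := g0 l; rewrite mxE.
by rewrite -[RHS](t1 l); apply: eq_bigr => i _; rewrite mxE mulr1.
Qed.
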